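(* Assume the standing setting below. Let $T>0$, $g\in C(\mathbb{R}^n)$, $c,f,\varphi\in C([0,T]\times\mathbb{R}^n)$, suppose $g\ge\varphi(T,\cdot)$ on $\mathbb{R}^n$, and suppose $\lim_{y\to0}F(x,y)=0$ for all $x\in\mathbb{R}^n$. If the evolution obstacle problem $$\min\{-\partial_tv-Lv+cv-f,\ v-\varphi\}=0\ \text{on }[0,T)\times\mathbb{R}^n,\qquad v(T,\cdot)=g\ \text{on }\mathbb{R}^n$$ has a viscosity solution, then it is unique.
   Context: Standing setting. $\nu$ is a Lévy measure on $\mathbb{R}^n\setminus\{0\}$. The drift $b:\mathbb{R}^n\to\mathbb{R}^n$ is bounded and Lipschitz. The jump coefficient $F:\mathbb{R}^n\times(\mathbb{R}^n\setminus\{0\})\to\mathbb{R}^n$ is measurable and there are $K>0$ and a measurable $\rho:\mathbb{R}^n\to[0,\infty)$ with $\int|F(x_1,y)-F(x_2,y)|^2\nu(dy)\le K|x_1-x_2|^2$, $\sup_{z\in B_{|y|}}|F(x,z)|\le\rho(y)$, and $\int(\max\{|y|,\rho(y)\})^2\nu(dy)\le K$. For $u$ with bounded continuous spatial derivatives up to order 2, $Lu(x)=b(x)\cdot\nabla u(x)+\int_{\mathbb{R}^n\setminus\{0\}}(u(x+F(x,y))-u(x)-F(x,y)\cdot\nabla u(x))\nu(dy)$ (applied in $x$ for each fixed $t$). $C(\cdot)$ denotes bounded continuous functions. $C^1_tC^2_x([0,T]\times\mathbb{R}^n)$: functions whose first time derivative and spatial derivatives up to order two are continuous and bounded. Viscosity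 solutions: $v\in C([0,T]\times\mathbb{R}^n)$ is a viscosity subsolution (supersolution) if $v(T,\cdot)\le g$ ($\ge g$) and for every $u\in C^1_tC^2_x([0,T]\times\mathbb{R}^n)$ such that $v-u$ has a global maximum (minimum) at $(t_0,x_0)\in[0,T)\times\mathbb{R}^n$ with $u(t_0,x_0)=v(t_0,x_0)$, one has $\min\{-\partial_tu(t_0,x_0)-Lu(t_0,x_0)+c(t_0,x_0)u(t_0,x_0)-f(t_0,x_0),\ u(t_0,x_0)-\varphi(t_0,x_0)\}\le0$ ($\ge0$); a viscosity solution is both. *)

(* Defs.v *)
From HB Require Import structures.
From mathcomp Require Import all_boot all_order all_algebra.
From mathcomp Require Import all_classical all_reals all_analysis.
Set Implicit Arguments. Unset Strict Implicit. Unset Printing Implicit Defensive.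
Import Order.TTheory GRing.Theory Num.Theory.
Import numFieldNormedType.Exports.
Local Open Scope classical_set_scope.
Local Open Scope ring_scope.

Definition borelRV (R : realType) (n : nat) :=
  g_sigma_algebraType (@open 'rV[R]_n).

Section Defs.
Variables (R : realType) (n : nat).
Local Notation V := 'rV[R]_n.

Definition enorm (x : V) : R := Num.sqrt (\sum_i (x 0 i) ^+ 2).
Definition dotp (x y : V) : R := \sum_i x 0 i * y 0 i.
Definition evec (i : 'I_n) : V := delta_mx 0 i.

Definition punct : set (borelRV R n) := ~` [set (0 : V)].

Definition levy_measure (nu : {measure set (borelRV R n) -> \bar R}) : Prop :=
  nu [set (0 : V)] = 0%E /\
  (\int[nu]_(y in punct) (Num.min 1 (enorm y ^+ 2))%:E < +oo)%E.

Definition standing_setting (nu : {measure set (borelRV R n) -> \bar R})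
  (b : V -> V) (F : V -> V -> V) (K : R) (rho : V -> R) : Prop :=
  levy_measure nu /\
  [/\ (exists M : R, forall x, enorm (b x) <= M),
      (exists Lb : R, forall x1 x2, enorm (b x1 - b x2) <= Lb * enorm (x1 - x2)),
      measurable_fun (setT `*` punct)
        (fun p : borelRV R n * borelRV R n => (F p.1 p.2 : borelRV R n)),
      0 < K &
      [/\ measurable_fun setT (rho : borelRV R n -> R),
          (forall y, 0 <= rho y),
          (forall x1 x2, (\int[nu]_(y in punct)
               (enorm (F x1 y - F x2 y) ^+ 2)%:E <= (K * enorm (x1 - x2) ^+ 2)%:E)%E),
          (forall x y z, z != 0 -> enorm z <= enorm y -> enorm (F x z) <= rho y) &
          (\int[nu]_(y in punct) ((Num.max (enorm y) (rho y)) ^+ 2)%:E <= K%:E)%E]].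

Definition bcont (T : R) (u : R -> V -> R) : Prop :=
  {within [set p : R * V | 0 <= p.1 <= T], continuous (fun p : R * V => u p.1 p.2)} /\
  exists M : R, forall t x, 0 <= t <= T -> `|u t x| <= M.

Definition bcontx (g : V -> R) : Prop :=
  continuous g /\ exists M : R, forall x, `|g x| <= M.

(* u in C^1_t C^2_x([0,T] x R^n), with time derivative ut (one-sided at the
   endpoints of [0,T]), gradient Du and Hessian D2u, all bounded continuous. *)
Definition C12 (T : R) (u ut : R -> V -> R) (Du : R -> V -> V)
  (D2u : R -> V -> 'M[R]_n) : Prop :=
  [/\ (forall t x, 0 <= t <= T ->
         (fun s => (s - t)^-1 * (u s x - u t x))
           @ within [set s | 0 <= s <= T /\ s != t] (nbhs t) --> ut t x),
      (forall t x i, 0 <= t <= T -> is_derive x (evec i) (u t) (Du t x 0 i)),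
      (forall t x i j, 0 <= t <= T ->
         is_derive x (evec j) (fun y => Du t y 0 i) (D2u t x i j)),
      bcont T u /\ bcont T ut &
      (forall i, bcont T (fun t x => Du t x 0 i)) /\
      (forall i j, bcont T (fun t x => D2u t x i j))].

Definition Lop (nu : {measure set (borelRV R n) -> \bar R}) (b : V -> V)
  (F : V -> V -> V) (u : R -> V -> R) (Du : R -> V -> V) (t : R) (x : V) : R :=
  dotp (b x) (Du t x) +
  Rintegral nu punct
    (fun y : borelRV R n => u t (x + F x y) - u t x - dotp (F x y) (Du t x)).

Definition visc_sub (nu : {measure set (borelRV R n) -> \bar R}) (b : V -> V)
  (F : V -> V -> V) (T : R) (g : V -> R) (c f phi : R -> V -> R)
  (v : R -> V -> R) : Prop :=
  [/\ bcont T v, (forall x, v T x <= g x) &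
      forall u ut Du D2u, C12 T u ut Du D2u ->
      forall t0 x0, 0 <= t0 < T ->
      (forall t x, 0 <= t <= T -> v t x - u t x <= v t0 x0 - u t0 x0) ->
      u t0 x0 = v t0 x0 ->
      Num.min (- ut t0 x0 - Lop nu b F u Du t0 x0 + c t0 x0 * u t0 x0 - f t0 x0)
           (u t0 x0 - phi t0 x0) <= 0].

Definition visc_super (nu : {measure set (borelRV R n) -> \bar R}) (b : V -> V)
  (F : V -> V -> V) (T : R) (g : V -> R) (c f phi : R -> V -> R)
  (v : R -> V -> R) : Prop :=
  [/\ bcont T v, (forall x, v T x >= g x) &
      forall u ut Du D2u, C12 T u ut Du D2u ->
      forall t0 x0, 0 <= t0 < T ->
      (forall t x, 0 <= t <= T -> v t x - u t x >= v t0 x0 - u t0 x0) ->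
      u t0 x0 = v t0 x0 ->
      Num.min (- ut t0 x0 - Lop nu b F u Du t0 x0 + c t0 x0 * u t0 x0 - f t0 x0)
           (u t0 x0 - phi t0 x0) >= 0].

Definition visc_solution nu b F T g c f phi v : Prop :=
  visc_sub nu b F T g c f phi v /\ visc_super nu b F T g c f phi v.

End Defs.

(* Main.v *)
Require Import Defs.
From HB Require Import structures.
From mathcomp Require Import all_boot all_order all_algebra.
From mathcomp Require Import all_classical all_reals all_analysis.
From mathcomp Require Import measurable_realfun.
From mathcomp Require Import ring lra.
Set Implicit Arguments.
Unset Strict Implicit.
Unset Printing Implicit Defensive.
Import Order.TTheory GRing.Theory Num.Theory.
Import numFieldNormedType.Exports.
Local Open Scope classical_set_scope.
Local Open Scope ring_scope.

(** Doubling of variables with the bounded penalties [1 - exp (- a |x|^2)] (localization)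
    and [N (1 - exp (- |t - s|^2 - |x - y|^2))] (coupling), and with [m exp (mu (T - t))]
    as time weight, where [m] is the supremum of [(v1 - v2) exp (- mu (T - t))] and [mu]
    dominates the sup norm of [c]. Since the equation has no second-order local term, no
    Jensen-Ishii lemma is needed: [r |-> 1 - exp (- r)] is concave, so at a maximum point
    the increments of the coupling under a pair of jumps [h], [k] are bounded by
    [|h - k|^2], and their integral by [K |x - y|^2].

    This requires the viscosity inequality with the solution itself inside the jump
    integral, while test functions must be smooth. Given a test function [phi] touching
    [v] from above at [(t0, x0)], there are smooth [u_k >= v] with the same first-order
    contact, [u_k <= phi + |x - x0|^2] and [limsup u_k <= v] at time [t0]: the function
    [u_k] is a convex combination, with smooth weights, of [phi] and of countably many
    Gaussian wells lying above [v]. Convex combinations of functions above [v] stay above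
    [v], and dominated convergence passes to the limit in the jump integral. *)

(** * Smooth bounded test functions *)

(** Gaussian penalties are forced by the class of test functions, whose values and derivatives must
    be bounded, so the usual quadratic penalties are not admissible. The jump integral with a
    solution inside need not exist on its own: contact with a test function bounds the compensated
    increment of [v] from one side only. Hence the limit is not taken in either viscosity inequality
    separately. The two are subtracted first; the doubled maximum then bounds the difference of the
    increments from above, and an upper bound on the limit superior is enough. No penalty parameter
    is sent to a limit either. A tolerance [d] is fixed against [m], then the localization rate [a],
    then the coupling strength [N], which depends on [a] through a modulus of continuity on a box of
    size about [1 / a]. Since [m] is a supremum, the coupling term at the maximum is at most
    [3 * d], so every Lipschitz error is a multiple of [d]. With [E] the time weight at the maximum,
    its derivative [mu * E] absorbs the contribution of [c] with [E] to spare; what remains is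
    [E <= d * Q] for a constant [Q] independent of [d], against [m <= E]. *)

Section DirectionalDerivatives.
Variables (R : realType) (U : normedModType R).
Implicit Types (u w : U -> R) (x v : U).

Lemma derive_quotient_line u x v :
  (fun h : R => h^-1 *: ((u \o shift x) (h *: v) - u x)) =
  (fun h : R => h^-1 *: (((fun s : R => u (x + s *: v)) \o shift (0 : R)) (h *: (1 : R))
     - (fun s : R => u (x + s *: v)) 0)).
Proof.
apply/funext => h /=; congr (_ *: (_ - _)); last by rewrite scale0r addr0.
by rewrite addr0 -[h *: 1]/(h * 1) mulr1 addrC.
Qed.

(** Reduces directional derivatives to one-variable derivatives at [0], so that the one-variable
    chain rule and explicit computations along a line apply. *)
Lemma is_derive_line u x v (d : R) :
  is_derive x v u d <-> is_derive (0 : R) 1 (fun s : R => u (x + s *: v)) d.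
Proof.
by split=> -[]; rewrite /derivable /derive => h1 h2; split;
   rewrite /derivable /derive -?derive_quotient_line // derive_quotient_line.
Qed.

End DirectionalDerivatives.

Section DirectionalCalculus.
Variables (R : realType) (U : normedModType R).
Implicit Types (u w : U -> R) (x v : U).

Lemma is_derive_line_at u x v (s d : R) :
  is_derive (x + s *: v) v u d ->
  is_derive s 1 (fun r : R => u (x + r *: v)) d.
Proof.
move=> /is_derive_line h; apply/is_derive_line.
suff -> : (fun r : R => u (x + (s + r *: 1) *: v)) =
          (fun r => u (x + s *: v + r *: v)) by [].
by apply/funext => r; rewrite -[r *: 1]/(r * 1) mulr1 scalerDl addrA.
Qed.

Lemma is_derive_rcomp u x v (f : R -> R) (df du : R) :
  is_derive (u x) 1 f df -> is_derive x v u du ->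
  is_derive x v (fun y => f (u y)) (df * du).
Proof.
move=> hf /is_derive_line hu; apply/is_derive_line.
apply: (@is_derive1_comp R f (fun s : R => u (x + s *: v))).
by rewrite scale0r addr0.
Qed.

Lemma is_derive_add u w x v (du dw : R) :
  is_derive x v u du -> is_derive x v w dw ->
  is_derive x v (fun y => u y + w y) (du + dw).
Proof. by move=> hu hw; exact: is_deriveD. Qed.

Lemma is_derive_mul u w x v (du dw : R) :
  is_derive x v u du -> is_derive x v w dw ->
  is_derive x v (fun y => u y * w y) (u x * dw + w x * du).
Proof. by move=> hu hw; exact: is_deriveM. Qed.

End DirectionalCalculus.

(** * Calculus of bounded smooth functions of time and space *)

Section Smooth.
Variables (R : realType) (n : nat) (T : R).
Local Notation V := 'rV[R]_n.
Implicit Types (u w : R -> V -> R).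

(** Continuity is asked on all of [R * V], which avoids the subspace topology of [bcont]. The bound
    is asked only for times in [[0, T]], since weights such as [expR (mu * (T - t))] are unbounded
    on the whole line. *)
Definition bjc u :=
  continuous (fun p : R * V => u p.1 p.2) /\
  exists M : R, forall t x, 0 <= t <= T -> `|u t x| <= M.

Lemma bjc_cst (a : R) : bjc (fun _ _ => a).
Proof. by split; [exact: cst_continuous | exists `|a|]. Qed.

Lemma bjcD u w : bjc u -> bjc w -> bjc (fun t x => u t x + w t x).
Proof.
move=> [cu [M hM]] [cw [N hN]]; split.
  by move=> p; apply: continuousD; [exact: cu | exact: cw].
exists (M + N) => t x ht; apply: le_trans (ler_normD _ _) _.
by apply: lerD; [exact: hM | exact: hN].
Qed.

Lemma bjcM u w : bjc u -> bjc w -> bjc (fun t x => u t x * w t x).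
Proof.
move=> [cu [M hM]] [cw [N hN]]; split.
  by move=> p; apply: continuousM; [exact: cu | exact: cw].
exists (M * N) => t x ht; rewrite normrM.
by apply: ler_pM => //; [exact: hM | exact: hN].
Qed.

Lemma bjc_comp (f : R -> R) u : continuous f ->
  continuous (fun p : R * V => u p.1 p.2) ->
  (exists M, forall t x, 0 <= t <= T -> `|f (u t x)| <= M) ->
  bjc (fun t x => f (u t x)).
Proof.
move=> cf cu hM; split => // p.
exact: (@continuous_comp _ _ _ (fun p : R * V => u p.1 p.2) f p (cu p) (cf _)).
Qed.

(** A stronger form of [C12], with two-sided time derivatives at every real time. It is stable under
    sums, products and composition, with explicit formulas for the derivatives. *)
Definition smooth u (ut : R -> V -> R) (Du : R -> V -> V)
    (D2u : R -> V -> 'M[R]_n) :=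
  [/\ (forall (t : R) x, is_derive t 1 (fun s => u s x) (ut t x)),
      (forall t x i, is_derive x (@evec R n i) (u t) (Du t x 0 i)),
      (forall t x i j,
         is_derive x (@evec R n j) (fun y => Du t y 0 i) (D2u t x i j)),
      bjc u /\ bjc ut &
      (forall i, bjc (fun t x => Du t x 0 i)) /\
      (forall i j, bjc (fun t x => D2u t x i j))].

Lemma smooth_cst (a : R) :
  smooth (fun _ _ => a) (fun _ _ => 0) (fun _ _ => 0) (fun _ _ => 0).
Proof.
split.
- by move=> t x; exact: is_derive_cst.
- by move=> t x i; rewrite mxE; exact: is_derive_cst.
- by move=> t x i j; rewrite !mxE; exact: is_derive_cst.
- by split; exact: bjc_cst.
- by split=> [i|i j]; rewrite mxE; exact: bjc_cst.
Qed.

Lemma smoothD u ut Du D2u w wt Dw D2w :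
  smooth u ut Du D2u -> smooth w wt Dw D2w ->
  smooth (fun t x => u t x + w t x) (fun t x => ut t x + wt t x)
         (fun t x => Du t x + Dw t x) (fun t x => D2u t x + D2w t x).
Proof.
move=> [u1 u2 u3 [u4 u5] [u6 u7]] [w1 w2 w3 [w4 w5] [w6 w7]]; split.
- by move=> t x; exact: is_derive_add.
- by move=> t x i; rewrite mxE; exact: is_derive_add.
- move=> t x i j; rewrite mxE; under eq_fun do rewrite /= ?mxE.
  exact: is_derive_add.
- by split; exact: bjcD.
- split=> [i|i j].
    under eq_fun do under eq_fun do rewrite /= ?mxE.
    exact: bjcD.
  under eq_fun do under eq_fun do rewrite /= ?mxE.
  exact: bjcD.
Qed.

Lemma smoothM u ut Du D2u w wt Dw D2w :
  smooth u ut Du D2u -> smooth w wt Dw D2w ->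
  smooth (fun t x => u t x * w t x) (fun t x => u t x * wt t x + w t x * ut t x)
         (fun t x => u t x *: Dw t x + w t x *: Du t x)
         (fun t x => \matrix_(i, j)
            ((u t x * D2w t x i j + Dw t x 0 i * Du t x 0 j) +
             (w t x * D2u t x i j + Du t x 0 i * Dw t x 0 j))).
Proof.
move=> [u1 u2 u3 [u4 u5] [u6 u7]] [w1 w2 w3 [w4 w5] [w6 w7]]; split.
- by move=> t x; exact: is_derive_mul.
- by move=> t x i; rewrite !mxE; exact: is_derive_mul.
- move=> t x i j; rewrite mxE; under eq_fun do rewrite /= ?mxE.
  by apply: is_derive_add; exact: is_derive_mul.
- split; first exact: bjcM.
  by apply: bjcD; exact: bjcM.
- split=> [i|i j].
    under eq_fun do under eq_fun do rewrite /= ?mxE.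
    by apply: bjcD; exact: bjcM.
  under eq_fun do under eq_fun do rewrite /= ?mxE.
  by apply: bjcD; apply: bjcD; exact: bjcM.
Qed.

Lemma smooth_comp (f f1 f2 : R -> R) u ut Du D2u :
  (forall s : R, is_derive s 1 f (f1 s)) -> (forall s : R, is_derive s 1 f1 (f2 s)) ->
  continuous f2 ->
  (exists M, forall t x, 0 <= t <= T ->
    [/\ `|f (u t x)| <= M, `|f1 (u t x)| <= M & `|f2 (u t x)| <= M]) ->
  smooth u ut Du D2u ->
  smooth (fun t x => f (u t x)) (fun t x => f1 (u t x) * ut t x)
         (fun t x => f1 (u t x) *: Du t x)
         (fun t x => \matrix_(i, j)
            (f1 (u t x) * D2u t x i j +
             Du t x 0 i * (f2 (u t x) * Du t x 0 j))).
Proof.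
move=> d1 d2 c2 [M hM] [u1 u2 u3 [u4 u5] [u6 u7]].
have der_cont (h h' : R -> R) : (forall s : R, is_derive s 1 h (h' s)) -> continuous h.
  by move=> dh s; apply: differentiable_continuous; exact/derivable1_diffP.
have cu : continuous (fun p : R * V => u p.1 p.2) by case: u4.
have b0 : bjc (fun t x => f (u t x)).
  apply: bjc_comp => //; first exact: der_cont d1.
  by exists M => t x ht; have [] := hM t x ht.
have b1 : bjc (fun t x => f1 (u t x)).
  apply: bjc_comp => //; first exact: der_cont d2.
  by exists M => t x ht; have [] := hM t x ht.
have b2 : bjc (fun t x => f2 (u t x)).
  by apply: bjc_comp => //; exists M => t x ht; have [] := hM t x ht.
split.
- by move=> t x; exact: is_derive_rcomp.
- by move=> t x i; rewrite !mxE; exact: is_derive_rcomp.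
- move=> t x i j; rewrite mxE; under eq_fun do rewrite /= ?mxE.
  by apply: is_derive_mul => //; exact: is_derive_rcomp.
- by split => //; exact: bjcM.
- split=> [i|i j].
    under eq_fun do under eq_fun do rewrite /= ?mxE.
    exact: bjcM.
  under eq_fun do under eq_fun do rewrite /= ?mxE.
  apply: bjcD; first exact: bjcM.
  by apply: bjcM => //; exact: bjcM.
Qed.

Lemma bjc_bcont u : bjc u -> bcont T u.
Proof. by move=> [cu hM]; split => //; exact: continuous_subspaceT. Qed.

Lemma smooth_C12 u ut Du D2u : smooth u ut Du D2u -> C12 T u ut Du D2u.
Proof.
move=> [u1 u2 u3 [u4 u5] [u6 u7]]; split.
- move=> t x ht.
  have [] := u1 t x; rewrite /derivable /derive => hc hl.
  have : (fun h : R => h^-1 *: (((fun s => u s x) \o shift t) (h *: (1:R)) - u t x)) @ 0^' --> ut t x.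
    by rewrite -hl.
  have -> : (fun s => (s - t)^-1 * (u s x - u t x)) =
    (fun h : R => h^-1 *: (((fun s => u s x) \o shift t) (h *: (1:R)) - u t x)) \o (fun s => s - t).
    apply/funext => s /=; rewrite -[(s - t) *: 1]/((s - t) * 1) mulr1.
    by rewrite subrK.
  apply: cvg_comp.
  move=> A /=; rewrite /dnbhs /within /= => hA.
  have ct : (fun s : R => s - t) @ t --> (0 : R).
    rewrite -(subrr t); apply: continuousB; [exact: cvg_id| exact: cvg_cst].
  have hB : \forall s \near t, s - t != 0 -> A (s - t) by exact: (ct _ hA).
  apply: filterS hB => s /= hs [_ st].
  by apply: hs; rewrite subr_eq0.
- by move=> t x i _.
- by move=> t x i j _.
- by split; exact: bjc_bcont.
- by split=> [i|i j]; exact: bjc_bcont.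
Qed.

End Smooth.

(** * Euclidean norm and Taylor bound *)

Section Euclid.
Variables (R : realType) (n : nat).
Local Notation V := 'rV[R]_n.
Implicit Types x y z : V.

Definition sq x : R := dotp x x.

Lemma dotpC x y : dotp x y = dotp y x.
Proof. by apply: eq_bigr => i _; rewrite mulrC. Qed.

Lemma dotpDl x y z : dotp (x + y) z = dotp x z + dotp y z.
Proof. by rewrite -big_split; apply: eq_bigr => i _; rewrite mxE mulrDl. Qed.

Lemma dotpZl (a : R) x y : dotp (a *: x) y = a * dotp x y.
Proof. by rewrite /dotp mulr_sumr; apply: eq_bigr => i _; rewrite mxE mulrA. Qed.

Lemma dotpNl x y : dotp (- x) y = - dotp x y.
Proof. by rewrite -scaleN1r dotpZl mulN1r. Qed.

Lemma dotpBl x y z : dotp (x - y) z = dotp x z - dotp y z.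
Proof. by rewrite dotpDl dotpNl. Qed.

Lemma dotpDr x y z : dotp z (x + y) = dotp z x + dotp z y.
Proof. by rewrite dotpC dotpDl !(dotpC z). Qed.

Lemma dotpZr (a : R) x y : dotp x (a *: y) = a * dotp x y.
Proof. by rewrite dotpC dotpZl dotpC. Qed.

Lemma dotpNr x y : dotp x (- y) = - dotp x y.
Proof. by rewrite dotpC dotpNl dotpC. Qed.

Lemma dotpBr x y z : dotp z (x - y) = dotp z x - dotp z y.
Proof. by rewrite dotpDr dotpNr. Qed.

Lemma dotp0l x : dotp (0 : V) x = 0.
Proof. by rewrite /dotp big1 // => i _; rewrite mxE mul0r. Qed.

Lemma dotp_evec i x : dotp (@evec R n i) x = x 0 i.
Proof.
rewrite /dotp (bigD1 i) //= big1 ?addr0 => [|j ji]; last first.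
  by rewrite mxE eqxx /= (negbTE ji) mul0r.
by rewrite mxE !eqxx mul1r.
Qed.

Lemma sq_ge0 x : 0 <= sq x.
Proof. by apply: sumr_ge0 => i _; rewrite -expr2 sqr_ge0. Qed.

Lemma enorm_sqr x : enorm x ^+ 2 = sq x.
Proof.
rewrite /enorm sqr_sqrtr; first by apply: eq_bigr => i _; rewrite expr2.
by apply: sumr_ge0 => i _; rewrite sqr_ge0.
Qed.

Lemma enorm_ge0 x : 0 <= enorm x. Proof. exact: sqrtr_ge0. Qed.

Lemma sqD x y : sq (x + y) = sq x + 2 * dotp x y + sq y.
Proof. rewrite /sq !dotpDl !dotpDr (dotpC y x); ring. Qed.

Lemma sqB x y : sq (x - y) = sq x - 2 * dotp x y + sq y.
Proof. rewrite /sq !dotpBl !dotpBr (dotpC y x); ring. Qed.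

Lemma sqN x : sq (- x) = sq x.
Proof. by rewrite /sq dotpNl dotpNr opprK. Qed.

Lemma sqZ (a : R) x : sq (a *: x) = a ^+ 2 * sq x.
Proof. by rewrite /sq dotpZl dotpZr mulrA expr2. Qed.

Lemma sq0 : sq (0 : V) = 0. Proof. exact: dotp0l. Qed.

Lemma sqBC x y : sq (x - y) = sq (y - x).
Proof. by rewrite -sqN opprB. Qed.

Lemma coord_sqr_le x i : x 0 i ^+ 2 <= sq x.
Proof.
rewrite /sq /dotp (bigD1 i) //= expr2 lerDl.
by apply: sumr_ge0 => j _; rewrite -expr2 sqr_ge0.
Qed.

Lemma coord_le_enorm x i : `|x 0 i| <= enorm x.
Proof.
rewrite -(@ler_pXn2r _ 2) ?nnegrE ?enorm_ge0 //.
by rewrite real_normK ?num_real // enorm_sqr coord_sqr_le.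
Qed.

Lemma sqD_le x y : sq (x + y) <= 2 * sq x + 2 * sq y.
Proof.
have := sq_ge0 (x - y); rewrite sqB sqD => h; lra.
Qed.

Lemma dotp_young x y : 2 * dotp x y <= sq x + sq y.
Proof. have := sq_ge0 (x - y); rewrite sqB => h; lra. Qed.

Lemma sq_eq0 x : sq x = 0 -> x = 0.
Proof.
move=> h; apply/rowP => i; rewrite mxE; apply/eqP.
rewrite -sqrf_eq0 eq_le sqr_ge0 andbT -h; exact: coord_sqr_le.
Qed.

Lemma continuous_coord (i : 'I_n) : continuous (fun x : V => x 0 i).
Proof. exact: coord_continuous. Qed.

End Euclid.

(** * Second-order Taylor bound from partial derivatives alone *)

Section Taylor.
Variables (R : realType) (n : nat).
Local Notation V := 'rV[R]_n.

(** Vertices of the path from [0] to [h] that changes one coordinate at a time. Only partial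
    derivatives are given, so increments are telescoped along this path instead of along a
    segment. *)
Definition trunc_row (h : V) (k : nat) : V :=
  \row_i (if (i < k)%N then h 0 i else 0).

Lemma trunc_row0 h : trunc_row h 0 = 0.
Proof. by apply/rowP => i; rewrite !mxE. Qed.

Lemma trunc_row_full h : trunc_row h n = h.
Proof. by apply/rowP => i; rewrite !mxE ltn_ord. Qed.

Lemma trunc_rowS h (k : 'I_n) :
  trunc_row h k.+1 = trunc_row h k + h 0 k *: @evec R n k.
Proof.
apply/rowP => i; rewrite !mxE eqxx /= ltnS leq_eqVlt.
have [->|ik] := eqVneq i k; first by rewrite eqxx ltnn /= mulr1 add0r.
by rewrite (negbTE (_ : nat_of_ord i != k)) //= mulr0 addr0.
Qed.

Variables (U : V -> R) (D : V -> V).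
Hypothesis dU : forall x i, is_derive x (@evec R n i) U (D x 0 i).

Lemma partial_MVT (a : V) (i : 'I_n) (s : R) :
  exists2 c : R, `|c| <= `|s| &
    U (a + s *: @evec R n i) - U a = s * D (a + c *: @evec R n i) 0 i.
Proof.
(* Rescaling to the unit interval lets [s] have either sign. *)
pose g r := U (a + (r * s) *: @evec R n i).
have dg (r : R) : is_derive r 1 g (D (a + (r * s) *: @evec R n i) 0 i * s).
  apply: (@is_derive1_comp R (fun r => U (a + r *: @evec R n i)) (fun r => r * s)).
    exact: is_derive_line_at.
  have -> : (fun r : R => r * s) = s \*: (id : R -> R).
    by apply/funext => q; rewrite mulrC.
  by apply: is_derive_eq; rewrite -[s *: 1]/(s * 1) mulr1.
have [|c hc] := @MVT_segment R g _ 0 1 ler01 (fun r _ => dg r).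
  apply: continuous_subspaceT => r.
  by apply: differentiable_continuous; exact/derivable1_diffP.
rewrite /g mul1r mul0r scale0r addr0 subr0 mulr1 => ->.
move: hc; rewrite in_itv /= => /andP[c0 c1].
exists (c * s); last by rewrite mulrC.
by rewrite normrM ger0_norm // ler_piMl.
Qed.

Lemma partial_lipschitz (C r : R) (x h : V) :
  (forall y i, `|D y 0 i| <= C) -> (forall i, `|h 0 i| <= r) ->
  `|U (x + h) - U x| <= C * r *+ n.
Proof.
move=> hD hr.
suff main : forall k, (k <= n)%N -> `|U (x + trunc_row h k) - U x| <= C * r *+ k.
  by have := main n (leqnn n); rewrite trunc_row_full.
elim=> [_|k IH kn]; first by rewrite trunc_row0 addr0 subrr normr0.
rewrite (trunc_rowS h (Ordinal kn)) /= addrA.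
have [c _ e] := partial_MVT (x + trunc_row h k) (Ordinal kn) (h 0 (Ordinal kn)).
rewrite -(subrKA (U (x + trunc_row h k))) e mulrS.
apply: le_trans (ler_normD _ _) _; apply: lerD; last exact: IH (ltnW kn).
by rewrite normrM mulrC; apply: ler_pM.
Qed.

End Taylor.

(** On each edge of the coordinate path, the mean value theorem turns the increment into [h 0 i]
    times a partial derivative at an intermediate point, and the Hessian bound compares that
    derivative with the one at [x]. Both telescoping sums have [n] terms, whence the factor
    [n%:R ^+ 2]. *)
Lemma taylor_bound (R : realType) (n : nat) (U : 'rV[R]_n -> R)
    (D : 'rV[R]_n -> 'rV[R]_n) (H : 'rV[R]_n -> 'M[R]_n) (C : R) (x h : 'rV[R]_n) :
  (forall x i, is_derive x (@evec R n i) U (D x 0 i)) ->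
  (forall x i j, is_derive x (@evec R n j) (fun y => D y 0 i) (H x i j)) ->
  (forall x i j, `|H x i j| <= C) ->
  `|U (x + h) - U x - dotp h (D x)| <= n%:R ^+ 2 * C * sq h.
Proof.
move=> dU dD hC; set r := enorm h.
have r0 : 0 <= r by exact: enorm_ge0.
have hr i : `|h 0 i| <= r by exact: coord_le_enorm.
have lipD (y z : 'rV[R]_n) i : (forall j, `|z 0 j| <= r) ->
    `|D (y + z) 0 i - D y 0 i| <= C * r *+ n.
  move=> hz.
  apply: (@partial_lipschitz R n (fun y => D y 0 i) (fun y => \row_j H y i j)) => //.
    by move=> w j; rewrite mxE.
  by move=> w j; rewrite mxE.
have main : forall k, (k <= n)%N ->
    `|U (x + trunc_row h k) - U x - dotp (trunc_row h k) (D x)|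
      <= (r * (C * r *+ n)) *+ k.
  elim=> [_|k IH kn].
    by rewrite trunc_row0 addr0 subrr dotp0l subr0 normr0.
  rewrite (trunc_rowS h (Ordinal kn)) /= addrA.
  set a := trunc_row h k; set i := Ordinal kn.
  have [c hc e] := partial_MVT dU (x + a) i (h 0 i).
  rewrite dotpDl dotpZl dotp_evec.
  have -> : U (x + a + h 0 i *: evec R i) - U x - (dotp a (D x) + h 0 i * D x 0 i)
    = h 0 i * (D (x + (a + c *: evec R i)) 0 i - D x 0 i)
      + (U (x + a) - U x - dotp a (D x)).
    have -> : U (x + a + h 0 i *: evec R i) =
        U (x + a) + h 0 i * D (x + a + c *: evec R i) 0 i by rewrite -e; ring.
    rewrite (addrA x a); ring.
  rewrite mulrS; apply: le_trans (ler_normD _ _) _.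
  apply: lerD; last exact: IH (ltnW kn).
  rewrite normrM; apply: ler_pM => //; apply: lipD => j.
  (* The intermediate displacement has the coordinates of [h] before [i], [c] at [i] and zeros
     afterwards, so each is at most [r] in absolute value. *)
  rewrite !mxE eqxx /=; case: ltnP => jk.
    have -> : (j == i) = false by apply/negbTE; rewrite -val_eqE /= ltn_eqF.
    by rewrite mulr0 addr0.
  rewrite add0r; case: (j == i); last by rewrite mulr0 normr0.
  by rewrite mulr1; apply: le_trans hc _.
have := main n (leqnn n); rewrite trunc_row_full => /le_trans; apply.
rewrite -enorm_sqr -/r -[X in X <= _]mulr_natr -[in X in X <= _](mulr_natr (C * r)).
by move: (n%:R : R) => N; suff -> : N ^+ 2 * C * r ^+ 2 = r * (C * r * N) * N by []; ring.
Qed.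

(** With [h] a jump, this makes the integrand of the nonlocal operator at most a multiple of the
    squared jump, which is integrable. *)
Lemma C12_taylor (R : realType) (n : nat) (T : R) (u ut : R -> 'rV[R]_n -> R) Du D2u :
  C12 T u ut Du D2u ->
  exists2 C : R, 0 <= C & forall t x h, 0 <= t <= T ->
    `|u t (x + h) - u t x - dotp h (Du t x)| <= C * sq h.
Proof.
move=> [_ d1 d2 _ [_ b2]].
have [N hN] : exists N : 'I_n -> 'I_n -> R,
    forall i j t x, 0 <= t <= T -> `|D2u t x i j| <= N i j.
  have h i : exists M : 'I_n -> R, forall j t x, 0 <= t <= T -> `|D2u t x i j| <= M j.
    have h' j : exists M : R, forall t x, 0 <= t <= T -> `|D2u t x i j| <= M.
      by have [_ [M hM]] := b2 i j; exists M.
    by have [M hM] := choice h'; exists M.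
  by have [M hM] := choice h; exists M.
pose C := \sum_i \sum_j `|N i j|.
have hC i j t x : 0 <= t <= T -> `|D2u t x i j| <= C.
  move=> ht; apply: le_trans (hN i j t x ht) _; apply: le_trans (ler_norm _) _.
  rewrite /C (bigD1 i) //= (bigD1 j) //= -addrA lerDl addr_ge0 ?sumr_ge0 // => k _.
  by rewrite sumr_ge0.
have C0 : 0 <= C by rewrite sumr_ge0 // => i _; rewrite sumr_ge0.
exists (n%:R ^+ 2 * C); first by rewrite mulr_ge0 ?sqr_ge0.
move=> t x h ht; apply: (@taylor_bound _ _ (u t) (Du t) (D2u t)).
- by move=> y i; exact: d1.
- by move=> y i j; exact: d2.
- by move=> y i j; exact: hC.
Qed.

(** * Gaussians and soft minima *)

Section ExpBounds.
Variable R : realType.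
Implicit Types r d s a b l : R.

Lemma expRN_ge1B r : 1 - r <= expR (- r).
Proof. exact: expR_ge1Dx. Qed.

Lemma expRN_le1 r : 0 <= r -> expR (- r) <= 1.
Proof. by move=> r0; rewrite -expR0 ler_expR lerNl oppr0. Qed.

(** Multiply [1 + r <= expR r] by [expR (- r)]. The right side is the profile of the penalties, the
    left side the shape of the errors they cause, so a small penalty forces small errors. *)
Lemma mulr_expRN_le r : r * expR (- r) <= 1 - expR (- r).
Proof.
have h := expR_ge1Dx r; have p := expR_gt0 (- r).
have e : expR r * expR (- r) = 1 by rewrite expRN mulfV // gt_eqF // expR_gt0.
have : (1 + r) * expR (- r) <= expR r * expR (- r) by rewrite ler_pM2r.
by rewrite e mulrDl mul1r => k; lra.
Qed.

Lemma mulr_expRN_le1 r : r * expR (- r) <= 1.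
Proof. by apply: le_trans (mulr_expRN_le r) _; rewrite gerBl expR_ge0. Qed.

Lemma expRN_le_inv r : 0 < r -> expR (- r) <= r^-1.
Proof.
move=> r0; rewrite -[r^-1]mul1r ler_pdivlMr // mulrC; exact: mulr_expRN_le1.
Qed.

(** The tangent at [r] lies above the concave graph; this amounts to [1 - d <= expR (- d)]. *)
Lemma one_sub_expRN_concave r d :
  1 - expR (- (r + d)) <= 1 - expR (- r) + expR (- r) * d.
Proof.
rewrite opprD expRD; have := expRN_ge1B d; have := expR_gt0 (- r) => h k.
have : expR (- r) * (1 - d) <= expR (- r) * expR (- d) by rewrite ler_pM2l.
by rewrite mulrBr mulr1 => j; lra.
Qed.

Definition logistic l s : R := (1 + expR (- (l * s)))^-1.

Lemma logistic_den_gt0 l s : 0 < 1 + expR (- (l * s)).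
Proof. by apply: ltr_pwDl; rewrite ?expR_ge0. Qed.

Lemma logistic_ge0 l s : 0 <= logistic l s.
Proof. by rewrite invr_ge0 ltW // logistic_den_gt0. Qed.

Lemma logistic_le1 l s : logistic l s <= 1.
Proof. by rewrite invf_le1 ?logistic_den_gt0 // lerDl expR_ge0. Qed.

Lemma onem_logistic l s : 1 - logistic l s = expR (- (l * s)) * logistic l s.
Proof.
have h := logistic_den_gt0 l s.
by rewrite /logistic -[X in X - _](@mulfV _ (1 + expR (- (l * s)))) ?gt_eqF //; ring.
Qed.

Lemma is_derive_logistic l s :
  is_derive s 1 (logistic l) (l * (logistic l s * (1 - logistic l s))).
Proof.
have dE : is_derive s 1 (fun r => 1 + expR (- (l * r))) (0 + expR (- (l * s)) * (- l)).
  apply: is_derive_add.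
  apply: is_derive_rcomp.
  have -> : (fun r : R => - (l * r)) = (- l) \*: (id : R -> R).
    by apply/funext => q /=; rewrite -mulNr.
  by apply: is_derive_eq; rewrite -[_ *: 1]/(_ * 1) mulr1.
have h : 1 + expR (- (l * s)) != 0 by rewrite gt_eqF // logistic_den_gt0.
have := @is_deriveV R (fun r => 1 + expR (- (l * r))) s _ 1 h dE.
rewrite /logistic => hd; apply: (is_derive_eq hd).
rewrite -[_ *: _]/(_ * _); field.
by [].
Qed.

Definition cvx s a b : R := s * a + (1 - s) * b.

Lemma cvx_ge s a b c : 0 <= s <= 1 -> c <= a -> c <= b -> c <= cvx s a b.
Proof.
move=> /andP[s0 s1] ca cb; rewrite /cvx -[c]mul1r -[X in X * c](subrKC s) mulrDl.
by apply: lerD; apply: ler_wpM2l => //; rewrite subr_ge0.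
Qed.

(** A smooth minimum written as a convex combination, with most of the weight on the smaller
    argument. Unlike the logarithm of a sum of exponentials, it never drops below a common lower
    bound of [a] and [b]. *)
Definition softmin l a b : R := cvx (logistic l (b - a)) a b.

(** With [s = b - a], the excess over [a] is [(1 - logistic l s) * s]. It is nonpositive for
    [s <= 0] and otherwise at most [s * expR (- (l * s))], hence at most [l^-1]. *)
Lemma softmin_lel l a b : 0 < l -> softmin l a b <= a + l^-1.
Proof.
move=> l0; rewrite /softmin /cvx; set s := b - a.
have -> : logistic l s * a + (1 - logistic l s) * b = a + (1 - logistic l s) * s.
  by rewrite /s; ring.
rewrite lerD2l onem_logistic.
have [s0|s0] := leP s 0.
  apply: (@le_trans _ _ (0)); last by rewrite invr_ge0 ltW.
  by rewrite mulr_ge0_le0 // mulr_ge0 ?expR_ge0 ?logistic_ge0.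
apply: (@le_trans _ _ (expR (- (l * s)) * s)).
  by rewrite ler_pM2r // ler_piMr ?expR_ge0 ?logistic_le1.
rewrite -[l^-1]mulr1 mulrC ler_pdivlMl // mulrA; exact: mulr_expRN_le1.
Qed.

Lemma softmin_ler l a b : 0 < l -> softmin l a b <= b + l^-1.
Proof.
move=> l0; rewrite /softmin /cvx; set s := b - a.
have -> : logistic l s * a + (1 - logistic l s) * b = b + logistic l s * (- s).
  by rewrite /s; ring.
rewrite lerD2l.
have [s0|s0] := leP 0 s.
  apply: (@le_trans _ _ (0)); last by rewrite invr_ge0 ltW.
  by rewrite mulr_ge0_le0 ?logistic_ge0 // oppr_le0.
rewrite -oppr_gt0 in s0.
apply: (@le_trans _ _ (expR (- (l * - s)) * (- s))).
  rewrite ler_pM2r // mulrN opprK /logistic expRN -[X in _ <= X]invrK.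
  by rewrite lef_pV2 ?posrE ?invr_gt0 ?expR_gt0 ?ltr_pwDl ?expR_ge0 ?invr_ge0 // lerDr.
rewrite -[l^-1]mulr1 mulrC ler_pdivlMl // mulrA; exact: mulr_expRN_le1.
Qed.

End ExpBounds.

Lemma continuous_fun_add (R : realType) (S : topologicalType) (f g : S -> R) :
  continuous f -> continuous g -> continuous (fun x => f x + g x).
Proof. by move=> cf cg x; apply: continuousD; [exact: cf | exact: cg]. Qed.

Lemma continuous_fun_mul (R : realType) (S : topologicalType) (f g : S -> R) :
  continuous f -> continuous g -> continuous (fun x => f x * g x).
Proof. by move=> cf cg x; apply: continuousM; [exact: cf | exact: cg]. Qed.

Lemma continuous_fun_opp (R : realType) (S : topologicalType) (f : S -> R) :
  continuous f -> continuous (fun x => - f x).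
Proof. by move=> cf x; apply: continuousN; exact: cf. Qed.

Lemma continuous_fun_comp (S1 S2 S3 : topologicalType) (g : S2 -> S3) (f : S1 -> S2) :
  continuous f -> continuous g -> continuous (fun x => g (f x)).
Proof.
by move=> cf cg x; apply: (@continuous_comp _ _ _ f g); [exact: cf | exact: cg].
Qed.

Lemma continuous_fst_fun (S1 S2 : topologicalType) :
  continuous (fun p : S1 * S2 => p.1).
Proof. by move=> p; exact: cvg_fst. Qed.

Lemma continuous_snd_fun (S1 S2 : topologicalType) :
  continuous (fun p : S1 * S2 => p.2).
Proof. by move=> p; exact: cvg_snd. Qed.

(** * Smooth weights, soft minima and Gaussians as test functions *)

Section SmoothFamily.
Variables (R : realType) (n : nat) (T : R).
Local Notation V := 'rV[R]_n.
Implicit Types (u w s : R -> V -> R).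

Definition smoothf u := exists ut Du D2u, smooth T u ut Du D2u.

(** The time derivative and gradient stay explicit because their values at the contact point are
    read off later; the Hessian only has to exist and be bounded and continuous. *)
Lemma smooth_cvx s st Ds D2s u ut Du D2u w wt Dw D2w :
  smooth T s st Ds D2s -> smooth T u ut Du D2u -> smooth T w wt Dw D2w ->
  exists D2z, smooth T (fun t x => cvx (s t x) (u t x) (w t x))
    (fun t x => cvx (s t x) (ut t x) (wt t x) + st t x * (u t x - w t x))
    (fun t x => s t x *: Du t x + (1 - s t x) *: Dw t x + (u t x - w t x) *: Ds t x)
    D2z.
Proof.
move=> hs hu hw.
have hz := smoothD (smoothM hs hu)
  (smoothM (smoothD (smooth_cst n T 1) (smoothM (smooth_cst n T (-1)) hs)) hw).
eexists; move: hz; congr smooth.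
- by apply/funext => t; apply/funext => x; rewrite /cvx; ring.
- by apply/funext => t; apply/funext => x; rewrite /cvx; ring.
- by apply/funext => t; apply/funext => x; apply/rowP => i; rewrite !mxE; ring.
Qed.

Lemma smoothf_cvx s u w : smoothf s -> smoothf u -> smoothf w ->
  smoothf (fun t x => cvx (s t x) (u t x) (w t x)).
Proof.
move=> [st [Ds [D2s hs]]] [ut [Du [D2u hu]]] [wt [Dw [D2w hw]]].
by have [D2z hz] := smooth_cvx hs hu hw; do 3!eexists; exact: hz.
Qed.

Lemma smoothf_cst (a : R) : smoothf (fun _ _ => a).
Proof. by do 3!eexists; exact: smooth_cst. Qed.

Lemma smoothfD u w : smoothf u -> smoothf w -> smoothf (fun t x => u t x + w t x).
Proof.
move=> [ut [Du [D2u hu]]] [wt [Dw [D2w hw]]].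
by do 3!eexists; exact: smoothD hu hw.
Qed.

Lemma smoothfM u w : smoothf u -> smoothf w -> smoothf (fun t x => u t x * w t x).
Proof.
move=> [ut [Du [D2u hu]]] [wt [Dw [D2w hw]]].
by do 3!eexists; exact: smoothM hu hw.
Qed.

(** The derivative of the logistic function is a polynomial in its value, and that value lies in
    [[0, 1]]; so the first two derivatives are bounded whatever the range of [u]. *)
Lemma smoothf_logistic (l : R) u :
  smoothf u -> smoothf (fun t x => logistic l (u t x)).
Proof.
move=> [ut [Du [D2u hu]]].
pose s1 r : R := l * (logistic l r * (1 - logistic l r)).
pose s2 r : R := l * (logistic l r * (0 + (-1) * s1 r + 0 * logistic l r)
                      + (1 - logistic l r) * s1 r).
have d1 (r : R) : is_derive r 1 (logistic l) (s1 r) by exact: is_derive_logistic.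
have d1m (r : R) : is_derive r 1 (fun r => 1 - logistic l r) (0 + (-1) * s1 r + 0 * logistic l r).
  apply: (is_derive_eq (f' := 0 + - s1 r)); last by rewrite mul0r addr0 mulN1r.
have d2 (r : R) : is_derive r 1 s1 (s2 r).
  apply: (is_derive_eq (f' := l * _ + (logistic l r * (1 - logistic l r)) * 0)).
    exact: (is_derive_mul (is_derive_cst l r 1) (is_derive_mul (d1 r) (d1m r))).
  by rewrite /s2 mulr0 addr0.
have cl : continuous (logistic l).
  by move=> r; apply: differentiable_continuous; exact/derivable1_diffP.
have c1 : continuous s1.
  by move=> r; apply: differentiable_continuous; exact/derivable1_diffP.
have c2 : continuous s2.
  move=> r; rewrite /s2; apply: cvgM; first exact: cvg_cst.
  apply: cvgD; apply: cvgM.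
  - exact: cl.
  - apply: cvgD; last by apply: cvgM; [exact: cvg_cst|exact: cl].
    by apply: cvgD; [exact: cvg_cst|apply: cvgM; [exact: cvg_cst|exact: c1]].
  - by apply: cvgB; [exact: cvg_cst|exact: cl].
  - exact: c1.
do 3!eexists; apply: smooth_comp d1 d2 c2 _ hu.
(* The three summands bound the logistic function, its first and its second derivative. *)
exists (1 + `|l| + 2 * `|l| * `|l|) => t x _.
set p := logistic l (u t x).
have p0 : 0 <= p by exact: logistic_ge0.
have p1 : p <= 1 by exact: logistic_le1.
have q1 : `|1 - p| <= 1 by rewrite ger0_norm ?subr_ge0 // gerBl.
have q2 : `|p| <= 1 by rewrite ger0_norm.
have b1 : `|s1 (u t x)| <= `|l|.
  rewrite /s1 -/p normrM ler_piMr // normrM -[X in _ <= X]mulr1; exact: ler_pM.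
have l0 := normr_ge0 l; have ll0 : 0 <= `|l| * `|l| by rewrite mulr_ge0.
split.
- by rewrite -/p; apply: le_trans q2 _; lra.
- by apply: le_trans b1 _; lra.
- rewrite /s2 -/p normrM.
  have : `|p * (0 + (-1) * s1 (u t x) + 0 * p) + (1 - p) * s1 (u t x)| <= 2 * `|l|.
    apply: le_trans (ler_normD _ _) _.
    have -> : 2 * `|l| = 1 * `|l| + 1 * `|l| by ring.
    apply: lerD; rewrite normrM; apply: ler_pM => //.
    by rewrite mul0r addr0 add0r mulN1r normrN.
  move=> h; apply: le_trans (ler_wpM2l l0 h) _.
  by rewrite mulrCA mulrA; lra.
Qed.

Lemma smoothf_softmin (l : R) u w : smoothf u -> smoothf w ->
  smoothf (fun t x => softmin l (u t x) (w t x)).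
Proof.
move=> hu hw; apply: smoothf_cvx => //; apply: smoothf_logistic.
have -> : (fun t x => w t x - u t x) = (fun t x => w t x + (-1) * u t x).
  by apply/funext => t; apply/funext => x; rewrite mulN1r.
by apply: smoothfD => //; apply: smoothfM => //; exact: smoothf_cst.
Qed.

(** Separate rates in time and space, centred at [(a, z)]. A zero time rate is allowed and gives a
    purely spatial well. *)
Definition gs (k l a : R) (z : V) (t : R) (x : V) : R :=
  expR (- (k * (t - a) ^+ 2 + l * sq (x - z))).

Lemma continuous_sq : continuous (@sq R n).
Proof.
rewrite /sq /dotp; move: (index_enum _) => r.
elim: r => [|i r IH].
  have -> : (fun x : V => \sum_(i <- [::]) x 0 i * x 0 i) = (fun=> 0).
    by apply/funext => x; rewrite big_nil.
  exact: cst_continuous.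
have -> : (fun x : V => \sum_(j <- i :: r) x 0 j * x 0 j) =
    (fun x => x 0 i * x 0 i + \sum_(j <- r) x 0 j * x 0 j).
  by apply/funext => x; rewrite big_cons.
apply: continuous_fun_add; last exact: IH.
by apply: continuous_fun_mul; exact: continuous_coord.
Qed.

Lemma gs_exponent_ge0 (k l a : R) (z : V) (t : R) (x : V) : 0 <= k -> 0 <= l ->
  0 <= k * (t - a) ^+ 2 + l * sq (x - z).
Proof. by move=> k0 l0; rewrite addr_ge0 // mulr_ge0 // ?sqr_ge0 ?sq_ge0. Qed.

Lemma gs_le1 (k l a : R) (z : V) (t : R) (x : V) : 0 <= k -> 0 <= l -> gs k l a z t x <= 1.
Proof. by move=> k0 l0; apply: expRN_le1; exact: gs_exponent_ge0. Qed.

Lemma gs_ge0 (k l a : R) (z : V) (t : R) (x : V) : 0 <= gs k l a z t x.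
Proof. exact: expR_ge0. Qed.

(** Along a line the exponent of a Gaussian is a quadratic polynomial in the parameter, so all
    derivatives of exponents come from this case. *)
Lemma is_derive_quad (A B C : R) :
  is_derive (0 : R) 1 (fun s : R => A + s * B + s * s * C) B.
Proof.
have id1 : is_derive (0 : R) 1 (fun s : R => s) 1 by exact: is_derive_id.
apply: (is_derive_eq (f' := 0 + (0 * 0 + B * 1) + (0 * 0 * 0 + C * (0 * 1 + 0 * 1)))).
  have c1 (a : R) : is_derive (0 : R) 1 (fun _ : R => a) 0 by exact: is_derive_cst.
  have h1 := is_derive_mul id1 (c1 B).
  have h2 := is_derive_mul (is_derive_mul id1 id1) (c1 C).
  exact: is_derive_add (is_derive_add (c1 A) h1) h2.
by ring.
Qed.

Lemma continuous_gs (k l a : R) (z : V) : continuous (fun p : R * V => gs k l a z p.1 p.2).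
Proof.
apply: (@continuous_fun_comp _ _ _ (@expR R)); last exact: continuous_expR.
apply: continuous_fun_opp; apply: continuous_fun_add;
  apply: continuous_fun_mul; try exact: cst_continuous.
  have c1 : continuous (fun q : R * V => q.1 - a).
    by apply: continuous_fun_add; [exact: continuous_fst_fun | exact: cst_continuous].
  have -> : (fun q : R * V => (q.1 - a) ^+ 2) = (fun q => (q.1 - a) * (q.1 - a)).
    by apply/funext => q; rewrite expr2.
  exact: continuous_fun_mul.
apply: (@continuous_fun_comp _ _ _ (@sq R n)); last exact: continuous_sq.
by move=> p; apply: continuousB; [exact: cvg_snd | exact: cst_continuous].
Qed.

Lemma smooth_gs (k l a : R) (z : V) : 0 <= k -> 0 <= l ->
  smooth T (gs k l a z)
    (fun t x => gs k l a z t x * (- (2 * k * (t - a))))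
    (fun t x => (gs k l a z t x * (- (2 * l))) *: (x - z))
    (fun t x => \matrix_(i, j) (gs k l a z t x * (- (2 * l)) * (i == j)%:R +
        (x - z) 0 i * ((- (2 * l)) * (gs k l a z t x * (- (2 * l * (x - z) 0 j)))))).
Proof.
move=> k0 l0.
have dt (t : R) x : is_derive t 1 (fun r => gs k l a z r x)
                (gs k l a z t x * (- (2 * k * (t - a)))).
  apply: (@is_derive_rcomp _ R
     (fun s : R => - (k * (s - a) ^+ 2 + l * sq (x - z))) _ _ (@expR R)).
  apply/is_derive_line.
  have -> : (fun s : R => - (k * (t + s *: 1 - a) ^+ 2 + l * sq (x - z))) =
    (fun s : R => - (k * (t - a) ^+ 2 + l * sq (x - z)) + s * (- (2 * k * (t - a))) + s * s * (- k)).
    by apply/funext => s; rewrite -[s *: 1]/(s * 1); ring.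
  exact: is_derive_quad.
have dx t x i : is_derive x (@evec R n i) (gs k l a z t)
                  (gs k l a z t x * (- (2 * l * (x - z) 0 i))).
  pose q (y : V) := - (k * (t - a) ^+ 2 + l * sq (y - z)).
  have hq : is_derive x (@evec R n i) q (- (2 * l * (x - z) 0 i)).
    apply/is_derive_line.
    have -> : (fun s : R => q (x + s *: @evec R n i)) =
      (fun s : R => q x + s * (- (2 * l * (x - z) 0 i)) + s * s * (- l * sq (@evec R n i))).
      apply/funext => s; rewrite /q.
      have -> : x + s *: @evec R n i - z = x - z + s *: @evec R n i by rewrite addrAC.
      rewrite (sqD (x - z)) sqZ dotpZr dotpC dotp_evec.
      by move: (sq (x - z)) (sq (@evec R n i)) ((x - z) 0 i) => A B C; ring.
    exact: is_derive_quad.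
  exact: (is_derive_rcomp (is_derive_expR (q x)) hq).
have cg := @continuous_gs k l a z.
have cc i : continuous (fun p : R * V => (p.2 - z) 0 i).
  apply: (@continuous_fun_comp _ _ _ (fun y : V => y 0 i)); last exact: continuous_coord.
  by move=> p; apply: continuousB; [exact: cvg_snd | exact: cst_continuous].
have bg : bjc T (gs k l a z).
  by split => //; exists 1 => t x _; rewrite ger0_norm ?gs_ge0 ?gs_le1.
(* bounds the Hessian, whose entries contain l (x - z)_i (x - z)_j exp(...) *)
have bound2 t x : l * sq (x - z) * gs k l a z t x <= 1.
  set r := k * (t - a) ^+ 2 + l * sq (x - z).
  apply: (@le_trans _ _ (r * expR (- r))); last exact: mulr_expRN_le1.
  by rewrite ler_wpM2r ?expR_ge0 // /r lerDr mulr_ge0 ?sqr_ge0.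
have bij i j : bjc T (fun t x => l * (x - z) 0 i * (x - z) 0 j * gs k l a z t x).
  split.
    apply: continuous_fun_mul; last exact: cg.
    apply: continuous_fun_mul; last exact: cc.
    by apply: continuous_fun_mul; [exact: cst_continuous | exact: cc].
  exists 1 => t x _; apply: le_trans (bound2 t x).
  rewrite !normrM (ger0_norm l0) (ger0_norm (gs_ge0 _ _ _ _ _ _)).
  apply: ler_wpM2r; first exact: gs_ge0.
  rewrite -mulrA; apply: ler_wpM2l => //.
  have := coord_sqr_le (x - z) i; have := coord_sqr_le (x - z) j.
  have := sqr_ge0 (`|(x - z) 0 i| - `|(x - z) 0 j|).
  rewrite sqrrB !real_normK ?num_real // -mulr_natr => h1 h2 h3; lra.
have bi i : bjc T (fun t x => l * (x - z) 0 i * gs k l a z t x).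
  split.
    apply: continuous_fun_mul; last exact: cg.
    by apply: continuous_fun_mul; [exact: cst_continuous | exact: cc].
  (* A coordinate is at most [1] plus its square, so the bound splits into [l] for the constant part
     and [1], from [bound2], for the quadratic part. *)
  exists (l + 1) => t x _.
  rewrite !normrM (ger0_norm l0) (ger0_norm (gs_ge0 _ _ _ _ _ _)).
  apply: (@le_trans _ _ ((l + l * sq (x - z)) * gs k l a z t x)).
    apply: ler_wpM2r; first exact: gs_ge0.
    have -> : l + l * sq (x - z) = l * (1 + sq (x - z)) by rewrite mulrDr mulr1.
    apply: ler_wpM2l => //.
    have := coord_sqr_le (x - z) i; have := sqr_ge0 (`|(x - z) 0 i| - 1).
    have := normr_ge0 ((x - z) 0 i).
    rewrite sqrrB !real_normK ?num_real // -mulr_natr => h1 h2 h3; lra.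
  by rewrite mulrDl; apply: lerD => //; apply: ler_piMr => //; exact: gs_le1.
split.
- exact: dt.
- move=> t x i.
  have -> : ((gs k l a z t x * - (2 * l)) *: (x - z)) 0 i =
      gs k l a z t x * - (2 * l * (x - z) 0 i) by rewrite [LHS]mxE; ring.
  exact: dx.
- move=> t x i j; rewrite [X in is_derive _ _ _ X]mxE.
  have -> : (fun y : V => ((gs k l a z t y * - (2 * l)) *: (y - z)) 0 i) =
      (fun y => gs k l a z t y * - (2 * l) * (y - z) 0 i).
    by apply/funext => y; rewrite [LHS]mxE.
  apply: is_derive_mul.
    apply: (is_derive_eq (f' := gs k l a z t x * 0 + - (2 * l) * (gs k l a z t x * - (2 * l * (x - z) 0 j)))).
      exact: (is_derive_mul (dx t x j) (is_derive_cst (- (2 * l)) x _)).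
    by rewrite mulr0 add0r.
  apply/is_derive_line.
  have -> : (fun s : R => (x + s *: @evec R n j - z) 0 i) =
    (fun s : R => (x - z) 0 i + s * (i == j)%:R + s * s * 0).
    by apply/funext => s; rewrite !mxE eqxx /=; ring.
  exact: is_derive_quad.
- split => //; apply: bjcM => //; split.
    apply: continuous_fun_opp; apply: continuous_fun_mul; first exact: cst_continuous.
    by apply: continuous_fun_add; [exact: continuous_fst_fun | exact: cst_continuous].
  exists (2 * k * (T + `|a|)) => t x /andP[t0 tT].
  rewrite normrN !normrM (ger0_norm k0) (ger0_norm (ler0n R 2)).
  rewrite ler_wpM2l ?mulr_ge0 //; apply: le_trans (ler_normB _ _) _.
  by rewrite lerD2r ger0_norm.
- split=> [i|i j].
    have -> : (fun t x => (gs k l a z t x * (- (2 * l)) *: (x - z)) 0 i) =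
      (fun t x => (-2) * (l * (x - z) 0 i * gs k l a z t x)).
      by apply/funext => t; apply/funext => x; rewrite [LHS]mxE; ring.
    by apply: bjcM => //; exact: bjc_cst.
  have -> : (fun t x => (\matrix_(i, j) (gs k l a z t x * (- (2 * l)) * (i == j)%:R +
        (x - z) 0 i * ((- (2 * l)) * (gs k l a z t x * (- (2 * l * (x - z) 0 j)))))) i j) =
     (fun t x => (- (2 * l) * (i == j)%:R) * gs k l a z t x +
       (4 * l) * (l * (x - z) 0 i * (x - z) 0 j * gs k l a z t x)).
    by apply/funext => t; apply/funext => x; rewrite [LHS]mxE; ring.
  by apply: bjcD; apply: bjcM => //; exact: bjc_cst.
Qed.

Lemma smoothf_gs (k l a : R) (z : V) : 0 <= k -> 0 <= l -> smoothf (gs k l a z).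
Proof. by move=> k0 l0; do 3!eexists; exact: smooth_gs. Qed.

End SmoothFamily.

(** * Approximating a viscosity solution from above *)

Section Approximation.
Variables (R : realType) (n : nat) (T : R).
Local Notation V := 'rV[R]_n.
Implicit Types (t r e : R) (x z : V).

Definition dist2 (t : R) (x : V) (s : R) (y : V) : R := (t - s) ^+ 2 + sq (x - y).

Lemma dist2_ge0 t x s y : 0 <= dist2 t x s y.
Proof. by rewrite addr_ge0 ?sqr_ge0 ?sq_ge0. Qed.

Lemma dist2_ball t0 x0 t x r : 0 < r -> dist2 t x t0 x0 < r ^+ 2 ->
  ball ((t0, x0) : R * V) r (t, x).
Proof.
move=> r0 h.
have sm (a : R) : a ^+ 2 <= dist2 t x t0 x0 -> `|a| < r.
  move=> ha; rewrite -(@ltr_pXn2r _ 2) ?nnegrE ?(ltW r0) //.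
  by rewrite real_normK ?num_real // (le_lt_trans ha).
split.
  rewrite /= /ball /= distrC; apply: sm.
  by rewrite /dist2 lerDl sq_ge0.
split=> // i j; rewrite /ball /= distrC; apply: sm.
have -> : x i j - x0 i j = (x - x0) 0 j by rewrite !mxE (ord1 i).
apply: le_trans (coord_sqr_le (x - x0) j) _.
by rewrite /dist2 lerDr sqr_ge0.
Qed.

Lemma continuous_dist2 (w : R -> V -> R) t0 x0 e :
  continuous (fun p : R * V => w p.1 p.2) -> 0 < e ->
  exists2 d, 0 < d & forall t x, dist2 t x t0 x0 < d -> `|w t x - w t0 x0| < e.
Proof.
move=> cw e0; have /cvgrPdist_lt /(_ e e0) := cw (t0, x0).
move=> /nbhs_ballP [r /= r0 hr]; exists (r ^+ 2); first exact: exprn_gt0.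
move=> t x h; rewrite distrC; exact: (hr (t, x) (dist2_ball r0 h)).
Qed.

(** Rational centres keep the family of wells countable. *)
Lemma rat_approx x e : 0 < e ->
  exists z : 'rV[rat]_n, sq (x - map_mx (@ratr R) z) <= e.
Proof.
move=> e0; pose d : R := Num.min 1 (e / n.+1%:R).
have d0 : 0 < d by rewrite lt_min ltr01 divr_gt0.
have hq i : exists q : rat, `|x 0 i - ratr q| <= d.
  have /rat_in_itvoo[q] : x 0 i - d < x 0 i + d by lra.
  rewrite in_itv /= => /andP[q1 q2]; exists q.
  by rewrite ler_norml; apply/andP; split; lra.
have [q qP] := choice hq; exists (\row_i q i).
rewrite /sq /dotp; apply: (@le_trans _ _ (\sum_(i < n) e / n.+1%:R)).
  apply: ler_sum => i _; rewrite !mxE -expr2 -real_normK ?num_real // expr2.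
  have qi := qP i; rewrite -[e / _]mul1r; apply: ler_pM => //.
    by apply: le_trans qi _; rewrite ge_min lexx.
  by apply: le_trans qi _; rewrite ge_min lexx orbT.
rewrite sumr_const card_ord -[X in X <= _]mulr_natr -mulrA.
apply: ler_piMr; first exact: ltW.
by rewrite mulrC ler_pdivrMr ?ltr0n // mul1r ler_nat.
Qed.

Variables (v : R -> V -> R) (M : R) (t0 : R) (x0 : V).
Hypothesis cv : continuous (fun p : R * V => v p.1 p.2).
Hypothesis vM : forall t x, `|v t x| <= M.

Lemma bound_ge0 : 0 <= M.
Proof. exact: le_trans (normr_ge0 (v 0 0)) (vM 0 0). Qed.

Definition local_vals (k : R) z : set R :=
  [set y | exists t x, k * dist2 t x t0 z <= 1 /\ y = v t x].

Lemma local_vals_has_sup (k : R) z : has_sup (local_vals k z).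
Proof.
split.
  exists (v t0 z), t0, z; split => //.
  by rewrite /dist2 !subrr sq0 expr0n /= addr0 mulr0.
by exists M => _ [t [x [_ ->]]]; apply: le_trans (vM t x); exact: ler_norm.
Qed.

(* Locally above [v] because of the supremum, far from the centre because of the Gaussian well. *)
Definition bump (k : R) z t x : R :=
  sup (local_vals k z) + (4 * M) * (1 + (-1) * gs k k t0 z t x).

Lemma expRN1_le_half : expR (- 1) <= 2^-1 :> R.
Proof.
by rewrite expRN lef_pV2 ?posrE ?expR_gt0 //; apply: le_trans (expR_ge1Dx 1).
Qed.

Lemma bump_ge (k : R) z t x : 0 <= k -> v t x <= bump k z t x.
Proof.
move=> k0; rewrite /bump mulN1r.
have M0 := bound_ge0.
have [hs1 hs2] := local_vals_has_sup k z.
have g1 : 0 <= 1 - gs k k t0 z t x by rewrite subr_ge0 gs_le1.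
have [near_|far] := leP (k * dist2 t x t0 z) 1.
  apply: (@le_trans _ _ (sup (local_vals k z))).
    by apply: sup_upper_bound => //; exists t, x.
  by rewrite lerDl !mulr_ge0.
have ge2 : gs k k t0 z t x <= 2^-1.
  apply: le_trans expRN1_le_half.
  by rewrite /gs ler_expR lerN2 -mulrDr ltW.
have sM : - M <= sup (local_vals k z).
  apply: (@le_trans _ _ (v t0 z)).
    by have := vM t0 z; rewrite ler_norml => /andP[].
  apply: sup_upper_bound => //; exists t0, z; split => //.
  by rewrite /dist2 !subrr sq0 expr0n /= addr0 mulr0.
have vt : v t x <= M by apply: le_trans (ler_norm _) (vM t x).
(* Away from the centre the well contributes at least [2 * M], the largest possible gap between a
   value of [v] and the supremum. *)
have : (4 * M) * 2^-1 <= (4 * M) * (1 - gs k k t0 z t x).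
  by apply: ler_wpM2l; [rewrite mulr_ge0|lra].
move=> h; lra.
Qed.

(** The rate is chosen before the centre: a large [k] makes the supremum local, and then [z] is
    taken so close to [x], relative to that [k], that the well is nearly zero at [x]. *)
Lemma bump_approx x e : 0 < e -> exists (z : 'rV[rat]_n) (k : nat),
  bump k.+1%:R (map_mx (@ratr R) z) t0 x <= v t0 x + e.
Proof.
move=> e0; have M0 := bound_ge0.
have [d d0 hd] := @continuous_dist2 v t0 x (e / 2) cv ltac:(lra).
(* Points counted in the supremum are at squared distance at most [1 / K] from the centre, and so is
   [x]; [sqD_le] then gives [4 / K] between them. *)
have [k hk] : exists k : nat, 4 / d < k.+1%:R.
  exists (Num.truncn (4 / d)); exact: truncnS_gt.
set K : R := k.+1%:R; have K0 : 0 < K by exact: ltr0Sn.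
have hKd : 4 / K < d by rewrite ltr_pdivrMr // mulrC -ltr_pdivrMr.
(* The first entry serves the supremum, the second makes the well term at [x] at most [e / 2]. Using
   [M + 1] avoids a division by zero. *)
pose eta := Num.min K^-1 (e / (8 * (M + 1) * K)).
have den0 : 0 < 8 * (M + 1) * K by rewrite !mulr_gt0 // ltr_wpDl.
have eta0 : 0 < eta by rewrite lt_min invr_gt0 K0 divr_gt0.
have [z hz] := rat_approx x eta0; exists z, k.
rewrite -/K; set zz := map_mx _ z in hz *.
have S : sup (local_vals K zz) <= v t0 x + e / 2.
  apply: ge_sup; first by have [] := local_vals_has_sup K zz.
  move=> _ [t [y [h ->]]].
  suff /hd : dist2 t y t0 x < d by rewrite ltr_norml => /andP[_]; lra.
  have h1 : dist2 t y t0 zz <= K^-1 by rewrite -[K^-1]mulr1 ler_pdivlMl.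
  have h2 : sq (y - x) <= 2 * sq (y - zz) + 2 * sq (x - zz).
    have -> : y - x = (y - zz) + - (x - zz) by rewrite opprB addrA subrK.
    by apply: le_trans (sqD_le _ _) _; rewrite sqN.
  have h3 : sq (x - zz) <= K^-1 by apply: le_trans hz _; rewrite ge_min lexx.
  have h4 := sq_ge0 (y - zz); have h5 := sqr_ge0 (t - t0).
  rewrite /dist2; move: h1 h2 h3 h4 h5 hKd; rewrite /dist2.
  move: K^-1 (sq _) (sq _) (sq _) (_ ^+ 2) => Ki a b c q; lra.
have G : (4 * M) * (1 + (-1) * gs K K t0 zz t0 x) <= e / 2.
  have hg : 1 - gs K K t0 zz t0 x <= K * eta.
    rewrite /gs subrr expr0n /= mulr0 add0r.
    have := expRN_ge1B (K * sq (x - zz)).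
    have : K * sq (x - zz) <= K * eta by rewrite ler_pM2l.
    lra.
  have he : K * eta <= K * (e / (8 * (M + 1) * K)).
    by rewrite ler_pM2l // ge_min lexx orbT.
  have -> : e / 2 = 4 * (M + 1) * (K * (e / (8 * (M + 1) * K))).
    field; rewrite !gt_eqF //; lra.
  rewrite mulN1r; apply: ler_pM.
  - by rewrite mulr_ge0.
  - by rewrite subr_ge0 gs_le1 // ltW.
  - lra.
  - exact: le_trans hg he.
rewrite /bump; lra.
Qed.

Variables (phi phit : R -> V -> R) (Dphi : R -> V -> V) (D2phi : R -> V -> 'M[R]_n).
Hypothesis sphi : smooth T phi phit Dphi D2phi.
Hypothesis t0T : 0 <= t0 <= T.
Hypothesis vphi : forall t x, 0 <= t <= T -> v t x <= phi t x.
Hypothesis touch0 : phi t0 x0 = v t0 x0.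

(** An enumeration of all wells with rational centre and integer rate. Integers encoding no pair
    fall back to [phi], which also lies above [v] on the time interval. *)
Definition barrier (j : nat) : R -> V -> R :=
  match @unpickle ('rV[rat]_n * nat)%type j with
  | Some q => bump q.2.+1%:R (map_mx (@ratr R) q.1)
  | None => phi
  end.

Lemma barrier_ge j t x : 0 <= t <= T -> v t x <= barrier j t x.
Proof.
by move=> ht; rewrite /barrier; case: unpickle => [q|]; [exact: bump_ge|exact: vphi].
Qed.

Lemma smoothf_barrier j : smoothf T (barrier j).
Proof.
rewrite /barrier; case: unpickle => [q|]; last by do 3!eexists; exact: sphi.
apply: smoothfD; first exact: smoothf_cst.
apply: smoothfM; first exact: smoothf_cst.
apply: smoothfD; first exact: smoothf_cst.
apply: smoothfM; first exact: smoothf_cst.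
exact: smoothf_gs.
Qed.

(** Soft minimum of [phi] and the first [k] barriers. Each step can raise the value above the exact
    minimum by at most [l^-1], hence the total errors [k%:R * l^-1] below. *)
Fixpoint softmin_seq (l : R) (k : nat) : R -> V -> R :=
  match k with
  | 0 => phi
  | k'.+1 => fun t x => softmin l (softmin_seq l k' t x) (barrier k' t x)
  end.

Lemma smoothf_softmin_seq l k : smoothf T (softmin_seq l k).
Proof.
elim: k => [|k IH] /=; first by do 3!eexists; exact: sphi.
by apply: smoothf_softmin => //; exact: smoothf_barrier.
Qed.

Lemma softmin_seq_ge l k t x : 0 <= t <= T -> v t x <= softmin_seq l k t x.
Proof.
move=> ht; elim: k => [|k IH] /=; first exact: vphi.
by apply: cvx_ge => //; [rewrite logistic_ge0 logistic_le1 | exact: barrier_ge].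
Qed.

Lemma softmin_seq_le l k t x : 0 < l -> softmin_seq l k t x <= phi t x + k%:R * l^-1.
Proof.
move=> l0; elim: k => [|k IH] /=; first by rewrite mul0r addr0.
apply: le_trans (softmin_lel _ _ l0) _.
by rewrite -natr1 mulrDl mul1r addrA lerD2r.
Qed.

Lemma softmin_seq_le_barrier l j k t x : 0 < l -> (j < k)%N ->
  softmin_seq l k t x <= barrier j t x + k%:R * l^-1.
Proof.
move=> l0; elim: k => // k IH; rewrite ltnS leq_eqVlt => /predU1P[->|jk] /=.
  apply: le_trans (softmin_ler _ _ l0) _; rewrite lerD2l.
  by rewrite -natr1 mulrDl mul1r lerDr mulr_ge0 // invr_ge0 ltW.
apply: le_trans (softmin_lel _ _ l0) _.
by rewrite -natr1 mulrDl mul1r addrA lerD2r IH.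
Qed.

(* The cutoff has value 1 and zero gradient at the contact point, so that the
   first-order data of [phi] survive there. *)
Definition cutoff (k : nat) : R -> V -> R := gs k.+1%:R k.+1%:R t0 x0.
Definition approx (k : nat) t x : R :=
  cvx (cutoff k t x) (phi t x) (softmin_seq (k.+1%:R ^+ 2) k t x).

Lemma cutoff_itv k t x : 0 <= cutoff k t x <= 1.
Proof. by rewrite gs_ge0 gs_le1. Qed.

Lemma cutoff_center k : cutoff k t0 x0 = 1.
Proof. by rewrite /cutoff /gs !subrr sq0 expr0n /= !mulr0 addr0 oppr0 expR0. Qed.

Lemma smooth_approx k : exists ut Du D2u,
  [/\ smooth T (approx k) ut Du D2u, ut t0 x0 = phit t0 x0 & Du t0 x0 = Dphi t0 x0].
Proof.
have [wt [Dw [D2w hw]]] := smoothf_softmin_seq (k.+1%:R ^+ 2) k.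
have k0 : 0 <= k.+1%:R :> R by [].
have [D2z hz] := smooth_cvx (smooth_gs T t0 x0 k0 k0) sphi hw.
do 3!eexists; split; first exact: hz.
  cbv beta; rewrite -/(cutoff k t0 x0) cutoff_center /cvx !subrr; ring.
cbv beta; rewrite -/(cutoff k t0 x0) cutoff_center !subrr scaler0 scaler0 addr0 scale0r.
by rewrite scale1r addr0.
Qed.

Lemma approx_ge k t x : 0 <= t <= T -> v t x <= approx k t x.
Proof.
move=> ht; apply: cvx_ge; [exact: cutoff_itv | exact: vphi |].
exact: softmin_seq_ge.
Qed.

Lemma approx_center k : approx k t0 x0 = v t0 x0.
Proof. by rewrite /approx cutoff_center /cvx subrr mul0r mul1r addr0 touch0. Qed.

(** The sharpness [k.+1%:R ^+ 2] is chosen so that the accumulated error of [k] soft minima still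
    vanishes. *)
Lemma seq_error (k : nat) : k%:R * (k.+1%:R ^+ 2)^-1 <= k.+1%:R^-1 :> R.
Proof.
rewrite ler_pdivrMr ?exprn_gt0 // expr2 mulrA mulVf ?mul1r ?gt_eqF //.
by rewrite ler_nat.
Qed.

(** The weight [1 - cutoff] is at most [k.+1%:R * sq (x - x0)] and multiplies an excess over [phi]
    of at most [k.+1%:R^-1]; the two rates cancel. The result is uniform in [k] and quadratic at the
    contact point, which is what a majorant of the jump integrands must be. *)
Lemma approx_le k x : approx k t0 x <= phi t0 x + sq (x - x0).
Proof.
have sl : softmin_seq (k.+1%:R ^+ 2) k t0 x <= phi t0 x + k.+1%:R^-1.
  apply: le_trans (softmin_seq_le _ _ _ _) _; first exact: exprn_gt0.
  by rewrite lerD2l seq_error.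
have /andP[c0 c1] := cutoff_itv k t0 x.
have c2 : 1 - cutoff k t0 x <= k.+1%:R * sq (x - x0).
  rewrite /cutoff /gs subrr expr0n /= mulr0 add0r.
  have := expRN_ge1B (k.+1%:R * sq (x - x0)).
  by move: (k.+1%:R * sq (x - x0)) => r h; lra.
have h1 : (1 - cutoff k t0 x) * (softmin_seq (k.+1%:R ^+ 2) k t0 x - phi t0 x)
    <= (1 - cutoff k t0 x) * k.+1%:R^-1.
  by apply: ler_wpM2l; rewrite ?subr_ge0 // lerBlDl.
have h2 : (1 - cutoff k t0 x) * k.+1%:R^-1 <= sq (x - x0).
  by rewrite ler_pdivrMr ?ltr0n // mulrC.
have := le_trans h1 h2; rewrite /approx /cvx.
move: (cutoff _ _ _) (softmin_seq _ _ _ _) => c s h; lra.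
Qed.

(** Away from [x0] the error has three parts of size [e / 3]: the gap of one good barrier [J], the
    soft minimum error once [k] exceeds [J], and the residual weight of [phi], which decays like the
    inverse of [k.+1%:R * sq (x - x0)]. *)
Lemma approx_limit x e : 0 < e -> \forall k \near \oo, approx k t0 x <= v t0 x + e.
Proof.
move=> e0.
have [->|xx0] := eqVneq x x0.
  by near=> k; rewrite approx_center lerDl ltW.
have d0 : 0 < sq (x - x0).
  rewrite lt_def sq_ge0 andbT; apply: contra_neq xx0 => h.
  by apply/eqP; rewrite -subr_eq0; apply/eqP; exact: sq_eq0.
have e3 : 0 < e / 3 by rewrite divr_gt0.
have [z [j hb]] := bump_approx x e3.
pose J := @pickle ('rV[rat]_n * nat)%type (z, j).
have eB : barrier J t0 x <= v t0 x + e / 3.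
  by rewrite /barrier /J pickleK.
pose A := phi t0 x - v t0 x.
have A0 : 0 <= A by rewrite subr_ge0 vphi.
near=> k.
have kJ : (J < k)%N by near: k; exact: nbhs_infty_gt.
have k1 : k.+1%:R^-1 <= e / 3.
  near: k; exists (Num.truncn (3 / e)).+1 => // k /= hk.
  rewrite -[k.+1%:R^-1]mul1r ler_pdivrMr ?ltr0n // -ler_pdivrMl ?divr_gt0 //.
  rewrite mulr1 invf_div; apply/ltW; apply: lt_le_trans (truncnS_gt _) _.
  by rewrite ler_nat; apply: leq_trans hk _.
have k2 : A / sq (x - x0) * k.+1%:R^-1 <= e / 3.
  near: k; exists (Num.truncn (A / sq (x - x0) * (3 / e))).+1 => // k /= hk.
  rewrite ler_pdivrMr ?ltr0n // -ler_pdivrMl ?divr_gt0 // invf_div mulrC.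
  apply/ltW; apply: lt_le_trans (truncnS_gt _) _.
  by rewrite ler_nat; apply: leq_trans hk _.
have sl : softmin_seq (k.+1%:R ^+ 2) k t0 x <= v t0 x + e / 3 + e / 3.
  apply: le_trans (softmin_seq_le_barrier _ _ _ kJ) _; first exact: exprn_gt0.
  apply: lerD => //; exact: le_trans (seq_error k) k1.
have /andP[c0 c1] := cutoff_itv k t0 x.
have c2 : cutoff k t0 x <= (k.+1%:R * sq (x - x0))^-1.
  rewrite /cutoff /gs subrr expr0n /= mulr0 add0r; apply: expRN_le_inv.
  by rewrite mulr_gt0.
have h1 : cutoff k t0 x * A <= e / 3.
  apply: le_trans k2; rewrite -mulrA mulrC.
  by apply: ler_wpM2l => //; rewrite -invfM mulrC.
have h2 : (1 - cutoff k t0 x) * (softmin_seq (k.+1%:R ^+ 2) k t0 x - v t0 x)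
    <= softmin_seq (k.+1%:R ^+ 2) k t0 x - v t0 x.
  by apply: ler_piMl; [rewrite subr_ge0 softmin_seq_ge | rewrite gerBl].
move: h1 h2 sl; rewrite /approx /cvx /A.
move: (cutoff _ _ _) (softmin_seq _ _ _ _) => c s h1 h2 sl; lra.
Unshelve. all: by end_near. Qed.

End Approximation.

(** * Jump integrals *)

(** A one-sided dominated convergence, in which [h k] need not converge or be bounded below
    uniformly in [k]. The functions [m k], maxima of [h k] and [G], do converge to [G] and lie
    between [G] and [H], so the usual theorem applies to them. *)
Lemma Rintegral_limsup_le (d : measure_display) (X : measurableType d)
    (R : realType) (mu : {measure set X -> \bar R}) (D : set X)
    (h : nat -> X -> R) (G H : X -> R) (e : R) :
  measurable D -> (forall k, mu.-integrable D (EFin \o h k)) ->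
  mu.-integrable D (EFin \o G) -> mu.-integrable D (EFin \o H) ->
  (forall k y, D y -> h k y <= H y) -> (forall y, D y -> G y <= H y) ->
  (forall y r, D y -> 0 < r -> \forall k \near \oo, h k y <= G y + r) ->
  0 < e ->
  \forall k \near \oo, Rintegral mu D (h k) <= Rintegral mu D G + e.
Proof.
move=> mD ih iG iH hH GH lim e0.
have mR f : mu.-integrable D (EFin \o f) -> measurable_fun D f.
  by move=> /integrableP[/measurable_EFinP].
pose m k y := Num.max (h k y) (G y).
have mm k : measurable_fun D (m k).
  by apply: measurable_maxr; exact: mR.
have iB : mu.-integrable D (fun y => `|(G y)%:E| + `|(H y)%:E|)%E.
  by apply: integrableD => //; exact: integrable_abse.
have mB k y : D y -> (`|(m k y)%:E| <= `|(G y)%:E| + `|(H y)%:E|)%E.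
  move=> Dy; rewrite !abse_EFin -EFinD lee_fin /m.
  have h1 := hH k y Dy; have h2 := GH y Dy.
  rewrite ler_norml; apply/andP; split.
    apply: (@le_trans _ _ (G y)); last by rewrite le_max lexx orbT.
    have := ler_norm (- G y); rewrite normrN; have := normr_ge0 (H y); lra.
  rewrite ge_max; apply/andP; split.
    by have := ler_norm (H y); have := normr_ge0 (G y); lra.
  by have := ler_norm (G y); have := normr_ge0 (H y); lra.
have ptw y : D y -> (fun k => (m k y)%:E) @ \oo --> (G y)%:E.
  move=> Dy; apply: cvg_EFin; first exact: nearW.
  apply/cvgrPdist_le => r r0; near=> k.
  rewrite /= distrC ger0_norm; last by rewrite subr_ge0 /m le_max lexx orbT.
  rewrite lerBlDr /m ge_max addrC; apply/andP; split; last by rewrite lerDl ltW.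
  by near: k; exact: lim.
have [iG' _ cv] := @dominated_convergence _ _ _ mu D mD (fun k y => (m k y)%:E)
    (fun y => (G y)%:E) (fun y => `|(G y)%:E| + `|(H y)%:E|)%E
    (fun k => (measurable_EFinP _ _).2 (mm k)) ((measurable_EFinP _ _).2 (mR _ iG))
    (aeW mu ptw) iB (aeW mu (fun y k Dy => mB k y Dy)).
have im k : mu.-integrable D (EFin \o m k).
  apply: (le_integrable mD _ _ iB); first exact/measurable_EFinP.
  move=> y Dy; apply: le_trans (mB k y Dy) _.
  by rewrite [leRHS]gee0_abs // adde_ge0.
have fin f : mu.-integrable D (EFin \o f) -> (\int[mu]_(y in D) (f y)%:E)%E \is a fin_num.
  by move=> ?; exact: integrable_fin_num.
have cvR : Rintegral mu D (m k) @[k --> \oo] --> Rintegral mu D G.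
  apply: fine_cvg; rewrite fineK; last exact: fin.
  exact: cv.
have /cvgrPdist_le /(_ e e0) := cvR; apply: filterS => k hk.
have le_hm : Rintegral mu D (h k) <= Rintegral mu D (m k).
  by apply: (le_Rintegral mD (ih k) (im k)) => y Dy; rewrite /m le_max lexx.
move: hk; rewrite ler_norml => /andP[hk _]; lra.
Unshelve. all: by end_near. Qed.

Lemma continuous_pair_cst (S1 S2 : topologicalType) (t : S1) :
  continuous (fun x : S2 => (t, x)).
Proof. by move=> z; apply: cvg_pair; [exact: cvg_cst | exact: cvg_id]. Qed.

Section JumpIntegrals.
Variables (R : realType) (n : nat).
Local Notation V := 'rV[R]_n.
Local Notation bV := (borelRV R n).
Local Notation pct := (@punct R n).
Variables (nu : {measure set bV -> \bar R}) (F : V -> V -> V) (K : R) (rho : V -> R).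
Hypothesis mF : measurable_fun (setT `*` pct)
  (fun p : bV * bV => (F p.1 p.2 : bV)).
Hypothesis mrho : measurable_fun setT (rho : bV -> R).
Hypothesis rho0 : forall y, 0 <= rho y.
Hypothesis FL : forall x1 x2, (\int[nu]_(y in pct)
  (enorm (F x1 y - F x2 y) ^+ 2)%:E <= (K * enorm (x1 - x2) ^+ 2)%:E)%E.
Hypothesis Frho : forall x y z, z != 0 -> enorm z <= enorm y -> enorm (F x z) <= rho y.
Hypothesis rhoK :
  (\int[nu]_(y in pct) ((Num.max (enorm y) (rho y)) ^+ 2)%:E <= K%:E)%E.

Lemma open_measurable_borelRV (A : set V) :
  open A -> measurable (A : set bV).
Proof. by move=> oA; exact: sub_sigma_algebra. Qed.

Lemma measurable_punct : measurable (pct : set bV).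
Proof.
apply: measurableC; rewrite -[X in measurable X]setCK; apply: measurableC.
apply: open_measurable_borelRV; rewrite openC.
have -> : [set (0 : V)] = (@sq R n) @^-1` [set 0].
  apply/seteqP; split => x /=; first by move=> ->; exact: sq0.
  exact: sq_eq0.
apply: closed_comp; last exact: closed_eq.
by move=> x _; exact: continuous_sq.
Qed.

Lemma measurable_jump x : measurable_fun pct (F x : bV -> bV).
Proof.
move=> mD B mB.
have h := mF (measurableX measurableT measurable_punct) mB.
have := @measurable_xsection _ _ bV bV _ x h.
rewrite xsectionE; congr measurable; apply/seteqP; split => y /=; first by case=> -[].
by move=> [? ?].
Qed.

Lemma measurable_cont_comp (g : V -> R) (h : bV -> bV) (D : set bV) :
  continuous g -> measurable_fun D h -> measurable_fun D (fun y => g (h y)).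
Proof.
move=> cg mh mD.
apply: (measurability _ (RGenOpens.measurableE R)) => // _ [_ [a [b ->] <-]].
apply: (mh mD (g @^-1` `]a, b[%classic)).
apply: open_measurable_borelRV; apply: open_comp; last exact: interval_open.
by move=> x _; exact: cg.
Qed.

Lemma jump_sq_le x y : pct y -> sq (F x y) <= rho y ^+ 2.
Proof.
move=> py; rewrite -enorm_sqr ler_pXn2r ?nnegrE ?enorm_ge0 //.
by apply: Frho => //; apply/eqP.
Qed.

Lemma measurable_rho2 : measurable_fun pct (fun y : bV => rho y ^+ 2).
Proof. by apply: measurable_funX; exact: measurable_funTS. Qed.

Lemma integral_rho2_le : (\int[nu]_(y in pct) (rho y ^+ 2)%:E <= K%:E)%E.
Proof.
apply: le_trans rhoK.
have mid : measurable_fun pct (id : bV -> bV) by exact: measurable_id.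
have me : measurable_fun pct (fun y : bV => enorm y).
  apply: (@measurable_cont_comp (@enorm R n) id) => //.
  apply: (@continuous_fun_comp _ _ _ (@Num.sqrt R) (fun x : V => \sum_i x 0 i ^+ 2)).
    have -> : (fun x : V => \sum_i x 0 i ^+ 2) = @sq R n.
      by apply/funext => x; apply: eq_bigr => i _; rewrite expr2.
    exact: continuous_sq.
  exact: sqrt_continuous.
apply: ge0_le_integral.
- exact: measurable_punct.
- by move=> y _; rewrite lee_fin sqr_ge0.
- by apply/measurable_EFinP; exact: measurable_rho2.
- apply/measurable_EFinP; apply: measurable_funX; apply: measurable_maxr => //.
  exact: measurable_funTS.
- move=> y _; have m0 : 0 <= Num.max (enorm y) (rho y) by rewrite le_max rho0 orbT.
  by rewrite lee_fin ler_pXn2r ?nnegrE // le_max lexx orbT.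
Qed.

Lemma integrable_rho2 : nu.-integrable pct (EFin \o (fun y : bV => rho y ^+ 2)).
Proof.
apply/integrableP; split; first by apply/measurable_EFinP; exact: measurable_rho2.
apply: le_lt_trans (ltry K); apply: le_trans integral_rho2_le.
rewrite le_eqVlt; apply/orP; left; apply/eqP; apply: eq_integral => y _ /=.
by rewrite ger0_norm // sqr_ge0.
Qed.

Lemma integrable_rho2Z (C : R) :
  nu.-integrable pct (EFin \o (fun y : bV => C * rho y ^+ 2)).
Proof. exact: (integrableZl measurable_punct C integrable_rho2). Qed.

Lemma integrable_rho2_bound (h : bV -> R) (C : R) :
  measurable_fun pct h -> (forall y, pct y -> `|h y| <= C * rho y ^+ 2) ->
  nu.-integrable pct (EFin \o h).
Proof.
move=> mh hC; apply: (le_integrable measurable_punct _ _ (integrable_rho2Z C)).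
  exact/measurable_EFinP.
move=> y py; rewrite /= lee_fin; apply: le_trans (hC y py) _; exact: ler_norm.
Qed.

Lemma measurable_jump_sq x : measurable_fun pct (fun y : bV => sq (F x y)).
Proof.
apply: (@measurable_cont_comp _ (F x)); [exact: continuous_sq|exact: measurable_jump].
Qed.

Lemma measurable_jump_coord x (i : 'I_n) :
  measurable_fun pct (fun y : bV => F x y 0 i).
Proof.
apply: (@measurable_cont_comp (fun z : V => z 0 i) (F x)).
  exact: continuous_coord.
exact: measurable_jump.
Qed.

Lemma measurable_jump_diff_sq x x' :
  measurable_fun pct (fun y : bV => sq (F x y - F x' y)).
Proof.
have -> : (fun y : bV => sq (F x y - F x' y)) =
  (fun y : bV => \sum_i (F x y 0 i - F x' y 0 i) * (F x y 0 i - F x' y 0 i)).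
  by apply/funext => y; apply: eq_bigr => i _; rewrite !mxE.
apply: measurable_sum => i.
by apply: measurable_funM; apply: measurable_funB; exact: measurable_jump_coord.
Qed.

Lemma integrable_jump_sq x : nu.-integrable pct (EFin \o (fun y : bV => sq (F x y))).
Proof.
apply: (@integrable_rho2_bound _ 1); first exact: measurable_jump_sq.
by move=> y py; rewrite mul1r ger0_norm ?sq_ge0 // jump_sq_le.
Qed.

Lemma integrable_jump_diff_sq x x' :
  nu.-integrable pct (EFin \o (fun y : bV => sq (F x y - F x' y))).
Proof.
apply: (@integrable_rho2_bound _ 4); first exact: measurable_jump_diff_sq.
move=> y py; rewrite ger0_norm ?sq_ge0 //; apply: le_trans (sqD_le _ _) _.
rewrite sqN; have := jump_sq_le x py; have := jump_sq_le x' py; lra.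
Qed.

Lemma Rintegral_jump_sq_le x : Rintegral nu pct (fun y : bV => sq (F x y)) <= K.
Proof.
have fin := integrable_fin_num measurable_punct (integrable_jump_sq x).
rewrite -lee_fin fineK //; apply: le_trans integral_rho2_le.
apply: ge0_le_integral.
- exact: measurable_punct.
- by move=> y _; rewrite lee_fin sq_ge0.
- by apply/measurable_EFinP; exact: measurable_jump_sq.
- by apply/measurable_EFinP; exact: measurable_rho2.
- by move=> y py; rewrite lee_fin jump_sq_le.
Qed.

Lemma Rintegral_jump_diff_sq_le x x' :
  Rintegral nu pct (fun y : bV => sq (F x y - F x' y)) <= K * sq (x - x').
Proof.
have fin := integrable_fin_num measurable_punct (integrable_jump_diff_sq x x').
rewrite -lee_fin fineK // -enorm_sqr; apply: le_trans (FL x x').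
rewrite le_eqVlt; apply/orP; left; apply/eqP; apply: eq_integral => y _ /=.
by rewrite enorm_sqr.
Qed.

(** The integrand of [Lop], with the gradient as a separate argument: it stays fixed at its contact
    value while the function runs through the approximants. *)
Definition jump_quot (u : V -> R) (p x : V) (y : bV) : R :=
  u (x + F x y) - u x - dotp (F x y) p.

Lemma integrable_jump_quot (T : R) (u ut : R -> V -> R) Du D2u t x :
  smooth T u ut Du D2u -> 0 <= t <= T ->
  nu.-integrable pct (EFin \o jump_quot (u t) (Du t x) x).
Proof.
move=> su ht; have [C C0 hC] := C12_taylor (smooth_C12 su).
apply: (@integrable_rho2_bound _ C).
  have cu : continuous (u t).
    have [_ _ _ [[cu _] _] _] := su.
    apply: (@continuous_fun_comp _ _ _ (fun p : R * V => u p.1 p.2) (fun x => (t, x))) => //.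
    exact: continuous_pair_cst.
  apply: measurable_funB.
    apply: measurable_funB; last exact: measurable_cst.
    apply: (@measurable_cont_comp (fun z => u t (x + z)) (F x)); last exact: measurable_jump.
    apply: (@continuous_fun_comp _ _ _ (u t) (fun z : V => x + z)) => //.
    by move=> z; apply: continuousD; [exact: cst_continuous | move=> A].
  rewrite /dotp; apply: measurable_sum => i.
  by apply: measurable_funM; [exact: measurable_jump_coord | exact: measurable_cst].
move=> y py; apply: le_trans (hC t x (F x y) ht) _.
by apply: ler_wpM2l => //; exact: jump_sq_le.
Qed.

(** In the application [a] comes from the localization and [c] from the coupling. The constant [C]
    supplies the integrable majorant; the estimate itself comes from the pointwise limit bound and
    the two integral bounds on the jumps. *)
Lemma jump_comparison (h h' : nat -> bV -> R) (x x' : V) (a c C e : R) :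
  (forall k, nu.-integrable pct (EFin \o h k)) ->
  (forall k, nu.-integrable pct (EFin \o h' k)) ->
  0 <= a -> 0 <= c ->
  (forall k y, pct y -> h k y - h' k y <= C * rho y ^+ 2) ->
  (forall y r, pct y -> 0 < r -> \forall k \near \oo,
     h k y - h' k y <= a * sq (F x y) + c * sq (F x y - F x' y) + r) ->
  0 < e ->
  \forall k \near \oo, Rintegral nu pct (h k) - Rintegral nu pct (h' k) <=
    a * K + c * (K * sq (x - x')) + e.
Proof.
move=> ih ih' a0 c0 hC lim e0.
have mp := measurable_punct.
pose G (y : bV) := a * sq (F x y) + c * sq (F x y - F x' y).
have iG1 : nu.-integrable pct (EFin \o (fun y : bV => a * sq (F x y))).
  exact: (integrableZl mp a (integrable_jump_sq x)).
have iG2 : nu.-integrable pct (EFin \o (fun y : bV => c * sq (F x y - F x' y))).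
  exact: (integrableZl mp c (integrable_jump_diff_sq x x')).
have iG : nu.-integrable pct (EFin \o G) by exact: (integrableD mp iG1 iG2).
have ihh k : nu.-integrable pct (EFin \o (fun y => h k y - h' k y)).
  exact: (integrableB mp (ih k) (ih' k)).
have GK : Rintegral nu pct G <= a * K + c * (K * sq (x - x')).
  have -> : Rintegral nu pct G = a * Rintegral nu pct (fun y : bV => sq (F x y)) +
      c * Rintegral nu pct (fun y : bV => sq (F x y - F x' y)).
    rewrite -(RintegralZl _ mp (integrable_jump_sq x)).
    rewrite -(RintegralZl _ mp (integrable_jump_diff_sq x x')).
    exact: (RintegralD mp iG1 iG2).
  apply: lerD; apply: ler_wpM2l => //.
    exact: Rintegral_jump_sq_le.
  exact: Rintegral_jump_diff_sq_le.
(* Chosen to dominate both the differences [h k - h' k] and [G]; the factor [4] bounds the squared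
   difference of two jumps, each at most [rho]. *)
pose C' := `|C| + a + 4 * c.
have iH := integrable_rho2Z C'.
have rho2 y : 0 <= rho y ^+ 2 by exact: sqr_ge0.
have := @Rintegral_limsup_le _ _ _ nu pct (fun k y => h k y - h' k y) G
  (fun y => C' * rho y ^+ 2) e mp ihh iG iH.
move=> /(_ _ _ lim e0) H.
have {}H : \forall k \near \oo, Rintegral nu pct (fun y => h k y - h' k y) <= Rintegral nu pct G + e.
  apply: H => [k y py|y py].
    apply: le_trans (hC k y py) _; apply: ler_wpM2r => //.
    by rewrite /C'; have := ler_norm C; lra.
  rewrite /G /C' mulrDl mulrDl -[X in X <= _]add0r -addrA; apply: lerD.
    by rewrite mulr_ge0.
  apply: lerD; first by apply: ler_wpM2l => //; exact: jump_sq_le.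
  rewrite -mulrA mulrCA; apply: ler_wpM2l => //.
  apply: le_trans (sqD_le _ _) _; rewrite sqN.
  have := jump_sq_le x py; have := jump_sq_le x' py; lra.
apply: filterS H => k; rewrite RintegralB // => hk; lra.
Qed.

End JumpIntegrals.

(** * Viscosity inequalities with the solution inside the jump integral *)

Section Clamp.
Variables (R : realType) (n : nat) (T : R).
Local Notation V := 'rV[R]_n.
Hypothesis T0 : 0 <= T.

(** Composing with [clamp] extends a function constantly in time beyond [[0, T]]; the approximation
    from above needs continuity and a bound on all of [R * V]. *)
Definition clamp (t : R) : R := Num.max 0 (Num.min t T).

Lemma clamp_itv t : 0 <= clamp t <= T.
Proof. by rewrite /clamp le_max lexx ge_max T0 ge_min lexx orbT. Qed.

Lemma clamp_id t : 0 <= t <= T -> clamp t = t.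
Proof. by move=> /andP[t0 tT]; rewrite /clamp min_l // max_r. Qed.

Lemma continuous_clamp : continuous clamp.
Proof.
move=> t; apply: (@continuous_max _ _ (fun=> 0) (fun t => Num.min t T)).
  exact: cst_continuous.
by apply: (@continuous_min _ _ id (fun=> T)); [move=> A|exact: cst_continuous].
Qed.

Definition clamped (w : R -> V -> R) (t : R) (x : V) : R := w (clamp t) x.

Lemma clampedE (w : R -> V -> R) t x : 0 <= t <= T -> clamped w t x = w t x.
Proof. by move=> ht; rewrite /clamped clamp_id. Qed.

Lemma continuous_clamped (w : R -> V -> R) :
  bcont T w -> continuous (fun p : R * V => clamped w p.1 p.2).
Proof.
move=> [cw _] p A hA.
pose S := [set p : R * V | 0 <= p.1 <= T].
pose q (p : R * V) := (clamp p.1, p.2).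
have Sq p' : S (q p') by exact: clamp_itv.
have c1 : clamp p'.1 @[p' --> p] --> clamp p.1.
  by apply: (@continuous_comp _ _ _ fst clamp); [exact: cvg_fst | exact: continuous_clamp].
have c2 : p'.2 @[p' --> p] --> p.2 by exact: cvg_snd.
have cq (B : set (R * V)) : nbhs (q p) B -> \forall p' \near p, B (q p').
  by move=> hB; exact: (cvg_pair c1 c2 hB).
have h2 : within S (nbhs (q p)) ((fun p' => w p'.1 p'.2) @^-1` A).
  by rewrite nbhs_subspace_in //; exact: (cw (q p) A hA).
have h3 : \forall p' \near p, S (q p') -> A (w (q p').1 (q p').2) by exact: (cq [set p' | S p' -> A (w p'.1 p'.2)] h2).
by apply: filterS h3 => p' /= hp'; exact: hp' (Sq p').
Qed.

Lemma bounded_clamped (w : R -> V -> R) :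
  bcont T w -> exists M, forall t x, `|clamped w t x| <= M.
Proof. by move=> [_ [M hM]]; exists M => t x; apply: hM; exact: clamp_itv. Qed.

End Clamp.

Section MoreSmooth.
Variables (R : realType) (n : nat) (T : R).
Local Notation V := 'rV[R]_n.

Lemma smoothN (u ut : R -> V -> R) Du D2u : smooth T u ut Du D2u ->
  exists D2w, smooth T (fun t x => - u t x) (fun t x => - ut t x)
    (fun t x => - Du t x) D2w.
Proof.
move=> hu; have hz := smoothM (smooth_cst n T (-1)) hu.
eexists; move: hz; congr smooth.
- by apply/funext => t; apply/funext => x; ring.
- by apply/funext => t; apply/funext => x; ring.
- by apply/funext => t; apply/funext => x; apply/rowP => i; rewrite !mxE; ring.
Qed.

Lemma smooth_expT (m mu : R) : 0 <= mu ->
  smooth T (fun t (x : V) => m * expR (mu * (T - t)))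
    (fun t x => - (mu * (m * expR (mu * (T - t)))))
    (fun _ _ => 0) (fun _ _ => 0).
Proof.
move=> mu0.
have cE : continuous (fun p : R * V => expR (mu * (T - p.1))).
  apply: (@continuous_fun_comp _ _ _ (@expR R)); last exact: continuous_expR.
  apply: continuous_fun_mul; first exact: cst_continuous.
  apply: continuous_fun_add; first exact: cst_continuous.
  by apply: continuous_fun_opp; exact: continuous_fst_fun.
have bE : bjc T (fun t (x : V) => expR (mu * (T - t))).
  split => //; exists (expR (mu * T)) => t x /andP[t0 tT].
  rewrite ger0_norm ?expR_ge0 // ler_expR; apply: ler_wpM2l => //; lra.
have bm : bjc T (fun t (x : V) => m * expR (mu * (T - t))).
  by apply: bjcM => //; exact: bjc_cst.
split.
- move=> t x; apply/is_derive_line.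
  pose g (s : R) := expR (mu * (T - t) + s * (- mu) + s * s * 0).
  have dg : is_derive (0 : R) 1 g (expR (mu * (T - t) + 0 * (- mu) + 0 * 0 * 0) * (- mu)).
    apply: (is_derive_rcomp (is_derive_expR _)); exact: is_derive_quad.
  have cm : is_derive (0 : R) 1 (fun _ : R => m) 0 by exact: is_derive_cst.
  have -> : (fun s : R => m * expR (mu * (T - (t + s *: 1)))) = (fun s => m * g s).
    apply/funext => s; rewrite /g -[s *: 1]/(s * 1); congr (_ * expR _); ring.
  apply: (is_derive_eq (is_derive_mul cm dg)).
  rewrite !mul0r mulr0 !addr0; ring.
- by move=> t x i; rewrite mxE; exact: is_derive_cst.
- by move=> t x i j; rewrite !mxE; exact: is_derive_cst.
- split => //.
  have -> : (fun t (x : V) => - (mu * (m * expR (mu * (T - t))))) =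
      (fun t x => (- mu) * (m * expR (mu * (T - t)))).
    by apply/funext => t; apply/funext => x; rewrite mulNr.
  by apply: bjcM => //; exact: bjc_cst.
- by split=> [i|i j]; rewrite mxE; exact: bjc_cst.
Qed.

End MoreSmooth.

(** * Transfer of the viscosity inequalities to the approximants *)

Section ViscosityJump.
Variables (R : realType) (n : nat).
Local Notation V := 'rV[R]_n.
Local Notation bV := (borelRV R n).
Local Notation pct := (@punct R n).
Variables (nu : {measure set bV -> \bar R}) (b : V -> V) (F : V -> V -> V)
  (K : R) (rho : V -> R).
Hypothesis sett : standing_setting nu b F K rho.
Variables (T : R) (g : V -> R) (c f phi : R -> V -> R).
Hypothesis T0 : 0 < T.

Let integrable_jq : forall (u ut : R -> V -> R) Du D2u t x,
  smooth T u ut Du D2u -> 0 <= t <= T ->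
  nu.-integrable pct (EFin \o jump_quot F (u t) (Du t x) x).
Proof.
have [_ [_ _ mF _ [mrho rho0 FL Frho rhoK]]] := sett.
move=> u ut Du D2u t x su ht; exact: (integrable_jump_quot _ mrho rho0 _ rhoK x su ht).
Qed.

(** The approximants share value, time derivative and gradient with [psi] at the contact point, so
    only the jump integral changes; the strict obstacle inequality rules out the other branch of the
    minimum. The conclusion keeps the sequence [U], because the increment of [v] itself need not be
    integrable. *)
Lemma visc_sub_jump (v psi psit : R -> V -> R) Dpsi D2psi t0 x0 :
  visc_sub nu b F T g c f phi v -> smooth T psi psit Dpsi D2psi ->
  0 <= t0 < T -> (forall t x, 0 <= t <= T -> v t x <= psi t x) ->
  psi t0 x0 = v t0 x0 -> phi t0 x0 < v t0 x0 ->
  exists U : nat -> V -> R,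
  [/\ (forall k, U k x0 = v t0 x0),
      (forall k x, U k x <= psi t0 x + sq (x - x0)),
      (forall x r, 0 < r -> \forall k \near \oo, U k x <= v t0 x + r),
      (forall k, nu.-integrable pct (EFin \o jump_quot F (U k) (Dpsi t0 x0) x0)) &
      (forall k, - psit t0 x0 - (dotp (b x0) (Dpsi t0 x0) +
         Rintegral nu pct (jump_quot F (U k) (Dpsi t0 x0) x0)) +
         c t0 x0 * v t0 x0 - f t0 x0 <= 0)].
Proof.
move=> [bv _ hv] spsi /andP[t00 t0T] vpsi touch obst.
have ht0 : 0 <= t0 <= T by rewrite t00 ltW.
have T0' := ltW T0.
have cv := continuous_clamped T0' bv.
have [M hM] := bounded_clamped T0' bv.
have vE t x : 0 <= t <= T -> clamped T v t x = v t x by exact: clampedE.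
have vpsi' t x : 0 <= t <= T -> clamped T v t x <= psi t x.
  by move=> ht; rewrite vE //; exact: vpsi.
have touch' : psi t0 x0 = clamped T v t0 x0 by rewrite vE.
pose U k := approx (clamped T v) M t0 x0 psi k.
have sU k := smooth_approx (clamped T v) M t0 x0 spsi k.
exists (fun k => U k t0); split.
- by move=> k; rewrite /U (approx_center _ touch') vE.
- by move=> k x; exact: approx_le.
- by move=> x r r0; rewrite -(vE t0 x ht0); exact: (approx_limit cv hM ht0).
- by move=> k; have [ut [Du [D2u [h _ <-]]]] := sU k; exact: integrable_jq h ht0.
- move=> k; have [ut [Du [D2u [h <- <-]]]] := sU k.
  have Uc : U k t0 x0 = v t0 x0 by rewrite /U (approx_center _ touch') vE.
  have H := hv _ _ _ _ (smooth_C12 h) t0 x0 (introT andP (conj t00 t0T)).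
  rewrite -/(U k) Uc in H.
  have : Num.min (- ut t0 x0 - Lop nu b F (U k) Du t0 x0 + c t0 x0 * v t0 x0 - f t0 x0)
      (v t0 x0 - phi t0 x0) <= 0.
    apply: H => // t x ht; rewrite subrr subr_le0 -(vE t x ht).
    exact: (approx_ge t0 x0 hM vpsi' k x ht).
  rewrite ge_min => /orP[|]; last by rewrite subr_le0 leNgt obst.
  by [].
Qed.

(** Phrased for [- v], so that the same approximation from above applies; [- U k] then serves as a
    test function from below. A nonnegative minimum yields the obstacle bound as well as the
    equation. *)
Lemma visc_super_jump (v psi psit : R -> V -> R) Dpsi D2psi t0 x0 :
  visc_super nu b F T g c f phi v -> smooth T psi psit Dpsi D2psi ->
  0 <= t0 < T -> (forall t x, 0 <= t <= T -> - v t x <= psi t x) ->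
  psi t0 x0 = - v t0 x0 ->
  phi t0 x0 <= v t0 x0 /\
  exists U : nat -> V -> R,
  [/\ (forall k, U k x0 = - v t0 x0),
      (forall k x, U k x <= psi t0 x + sq (x - x0)),
      (forall x r, 0 < r -> \forall k \near \oo, U k x <= - v t0 x + r),
      (forall k, nu.-integrable pct (EFin \o jump_quot F (U k) (Dpsi t0 x0) x0)) &
      (forall k, 0 <= psit t0 x0 + (dotp (b x0) (Dpsi t0 x0) +
         Rintegral nu pct (jump_quot F (U k) (Dpsi t0 x0) x0)) +
         c t0 x0 * v t0 x0 - f t0 x0)].
Proof.
move=> [bv _ hv] spsi /andP[t00 t0T] vpsi touch.
have ht0 : 0 <= t0 <= T by rewrite t00 ltW.
have T0' := ltW T0.
pose w t x := - clamped T v t x.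
have cw : continuous (fun p : R * V => w p.1 p.2).
  by apply: continuous_fun_opp; exact: continuous_clamped.
have [M hM'] := bounded_clamped T0' bv.
have hM t x : `|w t x| <= M by rewrite normrN.
have wE t x : 0 <= t <= T -> w t x = - v t x by move=> ht; rewrite /w clampedE.
have wpsi t x : 0 <= t <= T -> w t x <= psi t x.
  by move=> ht; rewrite wE //; exact: vpsi.
have touch' : psi t0 x0 = w t0 x0 by rewrite wE.
pose U k := approx w M t0 x0 psi k.
have sU k := smooth_approx w M t0 x0 spsi k.
have Uc k : U k t0 x0 = - v t0 x0 by rewrite /U (approx_center _ touch') wE.
have iU k : nu.-integrable pct (EFin \o jump_quot F (U k t0) (Dpsi t0 x0) x0).
  by have [ut [Du [D2u [h _ <-]]]] := sU k; exact: integrable_jq h ht0.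
have mp := @measurable_punct R n.
have main k : 0 <= psit t0 x0 + (dotp (b x0) (Dpsi t0 x0) +
         Rintegral nu pct (jump_quot F (U k t0) (Dpsi t0 x0) x0)) +
         c t0 x0 * v t0 x0 - f t0 x0 /\ phi t0 x0 <= v t0 x0.
  have [ut [Du [D2u [h e1 e2]]]] := sU k.
  have [D2w hw] := smoothN h.
  have Uc' : - U k t0 x0 = v t0 x0 by rewrite Uc opprK.
  have H := hv _ _ _ _ (smooth_C12 hw) t0 x0 (introT andP (conj t00 t0T)).
  have {H} : 0 <= Num.min
      (- - ut t0 x0 - Lop nu b F (fun t x => - U k t x) (fun t x => - Du t x) t0 x0
        + c t0 x0 * v t0 x0 - f t0 x0) (v t0 x0 - phi t0 x0).
    rewrite -{1 2}Uc'; apply: H; last exact: Uc'.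
    move=> t x ht; rewrite -/(U k) Uc' subrr opprK -[v t x]opprK -wE // addrC subr_ge0.
    exact: (approx_ge t0 x0 hM wpsi k x ht).
  rewrite le_min => /andP[H H2]; split; last by rewrite -subr_ge0.
  move: H; rewrite opprK /Lop e1 e2 dotpNr.
  have -> : (fun y : bV => - U k t0 (x0 + F x0 y) - - U k t0 x0 - dotp (F x0 y) (- Dpsi t0 x0))
    = (fun y : bV => (-1) * jump_quot F (U k t0) (Dpsi t0 x0) x0 y).
    by apply/funext => y; rewrite /jump_quot dotpNr; ring.
  rewrite RintegralZl // => H; lra.
split; first by have [] := main 0.
exists (fun k => U k t0); split => //.
- by move=> k x; exact: approx_le.
- by move=> x r r0; rewrite -(wE t0 x ht0); exact: (approx_limit cw hM ht0).
- by move=> k; have [] := main k.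
Qed.

End ViscosityJump.

(** * The doubling inequality *)

Section Penalty.
Variables (R : realType) (n : nat) (T : R).
Local Notation V := 'rV[R]_n.

Definition well (a : R) (x : V) : R := 1 - expR (- (a * sq x)).
Definition coupling (t : R) (x : V) (s : R) (y : V) : R :=
  1 - expR (- dist2 t x s y).

Lemma well_ge0 (a : R) (x : V) : 0 <= a -> 0 <= well a x.
Proof. by move=> a0; rewrite subr_ge0 expRN_le1 // mulr_ge0 // sq_ge0. Qed.

Lemma coupling_ge0 (t : R) (x : V) (s : R) (y : V) : 0 <= coupling t x s y.
Proof. by rewrite subr_ge0 expRN_le1 // dist2_ge0. Qed.

Lemma dist2C (t : R) (x : V) (s : R) (y : V) : dist2 t x s y = dist2 s y t x.
Proof. by rewrite /dist2 sqBC -sqrrN opprB. Qed.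

Lemma couplingC (t : R) (x : V) (s : R) (y : V) : coupling t x s y = coupling s y t x.
Proof. by rewrite /coupling dist2C. Qed.

(** Covers both test functions of the doubling argument: the one in [(t, x)], and with [m] and [A]
    zero the one in [(s, y)]. *)
Lemma smooth_penalty (C m mu A a N s : R) (y : V) : 0 <= mu -> 0 <= a ->
  exists pt Dp D2p,
  [/\ smooth T (fun t x => C + m * expR (mu * (T - t)) + A * well a x +
                           N * coupling t x s y) pt Dp D2p,
      (forall t x, pt t x = - (mu * (m * expR (mu * (T - t)))) +
         N * (expR (- dist2 t x s y) * (2 * (t - s)))) &
      (forall t x, Dp t x = (A * (expR (- (a * sq x)) * (2 * a))) *: x +
         (N * (expR (- dist2 t x s y) * 2)) *: (x - y))].
Proof.
move=> mu0 a0.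
have eg1 t x : gs 0 a 0 0 t x = expR (- (a * sq x)).
  by rewrite /gs mul0r add0r subr0.
have eg2 t x : gs 1 1 s y t x = expR (- dist2 t x s y).
  by rewrite /gs !mul1r.
(* Each penalty is a constant minus a Gaussian; the constants [A] and [N] are collected in the first
   summand. *)
have h := smoothD (smoothD (smoothD (smooth_cst n T (C + A + N)) (smooth_expT n T m mu0))
   (smoothM (smooth_cst n T (- A)) (smooth_gs T 0 0 (lexx 0) a0)))
   (smoothM (smooth_cst n T (- N)) (smooth_gs T s y ler01 ler01)).
have e : (fun t (x : V) => C + m * expR (mu * (T - t)) + A * well a x +
            N * coupling t x s y) =
    (fun t x => C + A + N + m * expR (mu * (T - t)) + (- A) * gs 0 a 0 0 t x +
      (- N) * gs 1 1 s y t x).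
  apply/funext => t; apply/funext => x; rewrite eg1 eg2 /well /coupling; ring.
rewrite e; do 3!eexists; split; first exact: h.
- move=> t x; cbv beta; rewrite eg1 eg2; ring.
- move=> t x; cbv beta; rewrite eg1 eg2; apply/rowP => i; rewrite !mxE; ring.
Qed.

Lemma well_concave (a : R) (x h : V) : 0 <= a ->
  well a (x + h) - well a x - expR (- (a * sq x)) * (2 * a) * dotp h x <= a * sq h.
Proof.
move=> a0; have := one_sub_expRN_concave (a * sq x) (a * (2 * dotp x h + sq h)).
rewrite /well -mulrDr addrA -sqD (dotpC h).
have e0 := expR_gt0 (- (a * sq x)).
have e1 : expR (- (a * sq x)) <= 1 by rewrite expRN_le1 // mulr_ge0 ?sq_ge0.
have : expR (- (a * sq x)) * (a * sq h) <= a * sq h.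
  by apply: ler_piMl => //; rewrite mulr_ge0 ?sq_ge0.
set E := expR (- (a * sq x)) in e0 e1 *; set E' := expR (- (a * sq (x + h))).
move: (sq h) (dotp x h) => q d h1 h2.
have -> : E * (2 * a) * d = E * (a * (2 * d + q)) - E * (a * q) by ring.
lra.
Qed.

(** Two simultaneous jumps change [x - y] only by [h - k]. The exponential weight is kept on the
    right, unlike in [well_concave]: [N] is large, and only with this weight is the error controlled
    by the coupling term. *)
Lemma coupling_concave (t : R) (x : V) (s : R) (y h k : V) :
  coupling t (x + h) s (y + k) - coupling t x s y -
    expR (- dist2 t x s y) * 2 * dotp (h - k) (x - y) <=
  expR (- dist2 t x s y) * sq (h - k).
Proof.
have e : dist2 t (x + h) s (y + k) =
    dist2 t x s y + (2 * dotp (x - y) (h - k) + sq (h - k)).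
  have -> : dist2 t (x + h) s (y + k) = (t - s) ^+ 2 + sq ((x - y) + (h - k)).
    by rewrite /dist2; congr (_ + sq _); rewrite opprD addrACA.
  by rewrite sqD /dist2 !addrA.
have := one_sub_expRN_concave (dist2 t x s y) (2 * dotp (x - y) (h - k) + sq (h - k)).
rewrite /coupling e (dotpC (h - k)).
set E := expR (- dist2 t x s y); set E' := expR (- (dist2 t x s y + _)).
move: (sq (h - k)) (dotp _ _) @E' => q d E' H.
have -> : E * 2 * d = E * (2 * d + q) - E * q by ring.
lra.
Qed.

End Penalty.

Section Doubling.
Variables (R : realType) (n : nat).
Local Notation V := 'rV[R]_n.
Local Notation bV := (borelRV R n).
Local Notation pct := (@punct R n).
Variables (nu : {measure set bV -> \bar R}) (b : V -> V) (F : V -> V -> V)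
  (K : R) (rho : V -> R).
Hypothesis sett : standing_setting nu b F K rho.
Variables (T : R) (g : V -> R) (c f phi : R -> V -> R).
Hypothesis T0 : 0 < T.
Variables (v1 v2 : R -> V -> R).
Hypothesis sub1 : visc_sub nu b F T g c f phi v1.
Hypothesis sup2 : visc_super nu b F T g c f phi v2.

Definition penalty (m mu A a N t : R) (x : V) (s : R) (y : V) : R :=
  m * expR (mu * (T - t)) + A * well a x + N * coupling t x s y.

(** Freezing one pair of variables turns the doubled maximum into a contact for the other. When the
    two inequalities are subtracted, the time derivatives of the coupling cancel and only that of
    the time weight survives; [r] absorbs the passage to the limit in the jump integrals. *)
Lemma doubling_inequality (m mu A a N t s : R) (x y : V) (r : R) :
  0 <= mu -> 0 <= A -> 0 <= a -> 0 <= N -> 0 <= t < T -> 0 <= s < T ->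
  (forall t' x' s' y', 0 <= t' <= T -> 0 <= s' <= T ->
     v1 t' x' - v2 s' y' - penalty m mu A a N t' x' s' y' <=
     v1 t x - v2 s y - penalty m mu A a N t x s y) ->
  phi t x - phi s y < v1 t x - v2 s y -> 0 < r ->
  mu * (m * expR (mu * (T - t))) <=
    A * (expR (- (a * sq x)) * (2 * a)) * dotp (b x) x +
    N * (expR (- dist2 t x s y) * 2) * dotp (b x - b y) (x - y) +
    (A * a * K + N * expR (- dist2 t x s y) * (K * sq (x - y))) -
    (c t x * v1 t x - c s y * v2 s y) + (f t x - f s y) + r.
Proof.
move=> mu0 A0 a0 N0 tT sT Hmax obst r0.
have [_ [_ _ mF _ [mrho rho0 FL Frho rhoK]]] := sett.
have ht : 0 <= t <= T by move: tT => /andP[-> /ltW].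
have hs : 0 <= s <= T by move: sT => /andP[-> /ltW].
set P := penalty m mu A a N t x s y in Hmax.
(* The additive constants make the test functions touch [v1] at [(t, x)] and [- v2] at [(s, y)]. The
   second has [m] and [A] zero because the time weight and the well involve only [(t, x)]. *)
have [p1 [D1 [D21 [sm1 ep1 eD1]]]] :=
  @smooth_penalty R n T (v1 t x - P) m mu A a N s y mu0 a0.
have [p2 [D2 [D22 [sm2 ep2 eD2]]]] :=
  @smooth_penalty R n T (- v2 s y - N * coupling t x s y) 0 mu 0 a N t x mu0 a0.
set psi1 := (X in smooth T X _ _ _) in sm1.
set psi2 := (X in smooth T X _ _ _) in sm2.
have psi1E t' x' : psi1 t' x' = v1 t x - P + penalty m mu A a N t' x' s y.
  by rewrite /psi1 /penalty; ring.
have psi2E s' y' : psi2 s' y' = - v2 s y - N * coupling t x s y + N * coupling t x s' y'.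
  by rewrite /psi2 (couplingC t x s' y'); ring.
have le1 t' x' : 0 <= t' <= T -> v1 t' x' <= psi1 t' x'.
  by move=> ht'; rewrite psi1E; have := Hmax t' x' s y ht' hs; lra.
have le2 s' y' : 0 <= s' <= T -> - v2 s' y' <= psi2 s' y'.
  move=> hs'; rewrite psi2E; have := Hmax t x s' y' ht hs'; rewrite /P /penalty; lra.
have tc1 : psi1 t x = v1 t x by rewrite psi1E subrK.
have tc2 : psi2 s y = - v2 s y by rewrite psi2E subrK.
(* The supersolution comes first: it gives [phi s y <= v2 s y], and with the hypothesis on the
   obstacle [v1] lies strictly above [phi] at [(t, x)]. *)
have [obst2 [U2 [U2c U2le U2lim U2int U2eq]]] :=
  visc_super_jump sett T0 sup2 sm2 sT le2 tc2.
have obst1 : phi t x < v1 t x by lra.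
have [U1 [U1c U1le U1lim U1int U1eq]] :=
  visc_sub_jump sett T0 sub1 sm1 tT le1 tc1 obst1.
set ex := expR (- (a * sq x)) in eD1 *.
set ed := expR (- dist2 t x s y) in eD1 *.
have exE : expR (- (a * sq x)) = ex by [].
have edE : expR (- dist2 t x s y) = ed by [].
have ed0 : 0 <= ed by exact: expR_ge0.
have ed1 : ed <= 1 by rewrite expRN_le1 // dist2_ge0.
have D1E : D1 t x = (A * (ex * (2 * a))) *: x + (N * (ed * 2)) *: (x - y).
  by rewrite eD1.
have D2E : D2 s y = (N * (ed * 2)) *: (y - x).
  by rewrite eD2 mul0r scale0r add0r (dist2C s y t x).
have mp := @measurable_punct R n.
pose h k := jump_quot F (U1 k) (D1 t x) x.
(* The sign is reversed because [U2] approximates [- v2]. *)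
pose h' k (z : bV) := (-1) * jump_quot F (U2 k) (D2 s y) y z.
have ih' k : nu.-integrable pct (EFin \o h' k) by exact: (integrableZl mp (-1) (U2int k)).
have q1 z : jump_quot F (psi1 t) (D1 t x) x z <= (A * a + N) * sq (F x z).
  rewrite /jump_quot !psi1E D1E dotpDr !dotpZr.
  have w1 := well_concave x (F x z) a0.
  have w2 := coupling_concave t x s y (F x z) 0.
  rewrite addr0 subr0 -/ed in w2; rewrite -/ex in w1.
  have {}w1 := ler_wpM2l A0 w1; have {}w2 := ler_wpM2l N0 w2.
  have w3 : N * (ed * sq (F x z)) <= N * sq (F x z).
    by apply: ler_wpM2l => //; apply: ler_piMl => //; exact: sq_ge0.
  rewrite /penalty.
  move: (well _ _) (well _ _) (coupling _ _ _ _) (coupling _ _ _ _) (sq _) (dotp _ _) (dotp _ _) w1 w2 w3 => W W' Q Q' S d d' w1 w2 w3.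
  lra.
have q2 z : jump_quot F (psi2 s) (D2 s y) y z <= N * sq (F y z).
  rewrite /jump_quot !psi2E D2E !dotpZr.
  have w2 := coupling_concave t x s y 0 (F y z).
  rewrite addr0 sub0r dotpNl sqN -/ed in w2.
  have {}w2 := ler_wpM2l N0 w2.
  have w3 : N * (ed * sq (F y z)) <= N * sq (F y z).
    by apply: ler_wpM2l => //; apply: ler_piMl => //; exact: sq_ge0.
  have -> : dotp (F y z) (y - x) = - dotp (F y z) (x - y) by rewrite -dotpNr opprB.
  move: (coupling _ _ _ _) (coupling _ _ _ _) (sq _) (dotp _ _) w2 w3 => Q Q' S d w2 w3.
  lra.
have N0' : 0 <= N * ed by rewrite mulr_ge0.
have Aa0 : 0 <= A * a by rewrite mulr_ge0.
(* The majorant constant is the sum of [A * a + N + 1] and [N + 1]: the separate bounds [q1] and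
   [q2] for the test functions, plus one for each quadratic excess of the approximants. *)
have JC := @jump_comparison R n nu F K rho mF mrho rho0 FL Frho rhoK h h' x y
  (A * a) (N * ed) (A * a + 2 * N + 2) r U1int ih' Aa0 N0' _ _ r0.
have hC k z : pct z -> h k z - h' k z <= (A * a + 2 * N + 2) * rho z ^+ 2.
  move=> pz; have f1 := jump_sq_le rho0 Frho x pz; have f2 := jump_sq_le rho0 Frho y pz.
  have u1 := U1le k (x + F x z); have u2 := U2le k (y + F y z).
  have j1 : h k z <= (A * a + N + 1) * sq (F x z).
    have := q1 z; rewrite /h /jump_quot U1c tc1.
    have -> : (A * a + N + 1) * sq (F x z) = (A * a + N) * sq (F x z) + sq (F x z) by ring.
    have e : x + F x z - x = F x z by rewrite addrC addKr.
    rewrite e in u1 => q; lra.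
  have j2 : - h' k z <= (N + 1) * sq (F y z).
    have := q2 z; rewrite /h' /jump_quot U2c tc2.
    have -> : (N + 1) * sq (F y z) = N * sq (F y z) + sq (F y z) by ring.
    have e : y + F y z - y = F y z by rewrite addrC addKr.
    rewrite e in u2 => q; lra.
  have k1 : (A * a + N + 1) * sq (F x z) <= (A * a + N + 1) * rho z ^+ 2.
    by apply: ler_wpM2l => //; rewrite !addr_ge0.
  have k2 : (N + 1) * sq (F y z) <= (N + 1) * rho z ^+ 2.
    by apply: ler_wpM2l => //; rewrite !addr_ge0.
  have -> : (A * a + 2 * N + 2) * rho z ^+ 2 =
    (A * a + N + 1) * rho z ^+ 2 + (N + 1) * rho z ^+ 2 by ring.
  by apply: lerD; [exact: le_trans j1 k1 | exact: le_trans j2 k2].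
have hlim z e : pct z -> 0 < e -> \forall k \near \oo,
    h k z - h' k z <= A * a * sq (F x z) + N * ed * sq (F x z - F y z) + e.
  move=> pz e0; have e2 : 0 < e / 2 by rewrite divr_gt0.
  near=> k.
  have u1 : U1 k (x + F x z) <= v1 t (x + F x z) + e / 2 by near: k; exact: U1lim.
  have u2 : U2 k (y + F y z) <= - v2 s (y + F y z) + e / 2 by near: k; exact: U2lim.
  (* The maximum property is tested with both points jumping under the same mark [z], which makes
     only the difference of the jumps enter the coupling. *)
  have H := Hmax t (x + F x z) s (y + F y z) ht hs.
  have w1 := ler_wpM2l A0 (well_concave x (F x z) a0).
  have w2 := ler_wpM2l N0 (coupling_concave t x s y (F x z) (F y z)).
  rewrite /h /h' /jump_quot U1c U2c D1E D2E dotpDr !dotpZr.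
  have -> : dotp (F y z) (y - x) = - dotp (F y z) (x - y) by rewrite -dotpNr opprB.
  rewrite -/ed dotpBl in w2; rewrite -/ex in w1; rewrite /P /penalty in H.
  move: (U1 k _) (U2 k _) (v1 t (x + _)) (v2 s (y + _)) (well _ _) (well _ _) (coupling _ _ _ _) (coupling _ _ _ _)
    (sq _) (sq _) (dotp _ _) (dotp _ _) (dotp _ _) u1 u2 H w1 w2
    => a1 a2 a3 a4 a5 a6 a7 a8 a9 a10 a11 a12 a13 u1 u2 H w1 w2.
  lra.
have /filter_ex [k hk] := JC hC hlim.
have E1 := U1eq k; have E2 := U2eq k.
have e' : Rintegral nu pct (h' k) = - Rintegral nu pct (jump_quot F (U2 k) (D2 s y) y).
  by rewrite RintegralZl // mulN1r.
rewrite e' /h in hk.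
move: E1 E2 hk; rewrite ep1 ep2 -?(dist2C t x s y) ?exE ?edE.
have -> : dotp (b x) (D1 t x) = A * (ex * (2 * a)) * dotp (b x) x +
    N * (ed * 2) * dotp (b x) (x - y) by rewrite D1E (dotpDr ((A * (ex * (2 * a))) *: x)) !dotpZr.
have -> : dotp (b y) (D2 s y) = - (N * (ed * 2) * dotp (b y) (x - y)).
  by rewrite D2E dotpZr -mulrN -dotpNr opprB.
rewrite dotpBl.
move: (Rintegral _ _ _) (Rintegral _ _ _) (dotp _ _) (dotp _ _) (dotp _ _) (sq _)
  => I1 I2 d1 d2 d3 S E1 E2 hk.
lra.
Unshelve. all: by end_near. Qed.

End Doubling.

(** * Comparison *)

Lemma continuous_fun_sub (R : realType) (W : normedModType R) (S : topologicalType)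
    (f g : S -> W) :
  continuous f -> continuous g -> continuous (fun x => f x - g x).
Proof. by move=> cf cg x; apply: continuousB; [exact: cf | exact: cg]. Qed.

(** * Compact boxes and uniform continuity *)

Section Compactness.
Variables (R : realType) (n : nat).
Local Notation V := 'rV[R]_n.

Definition box (T B : R) : set (R * V) :=
  [set p : R * V | 0 <= p.1 <= T /\ forall i, `|p.2 0 i| <= B].

Lemma compact_box (T B : R) : compact (box T B).
Proof.
have -> : box T B = `[0, T]%classic `*` [set x : V | forall i, `[- B, B]%classic (x ord0 i)].
  apply/seteqP; split=> -[t x] /=.
    by move=> [ht hx]; split; rewrite ?in_itv //= => i; rewrite in_itv /= -ler_norml.
  move=> [ht hx]; split; first by move: ht; rewrite in_itv.
  by move=> i; have := hx i; rewrite /= in_itv /= -ler_norml.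
apply: compact_setX; first exact: segment_compact.
by apply: (@rV_compact R n (fun=> `[- B, B]%classic)) => i; exact: segment_compact.
Qed.

Lemma near_dist2 (p : R * V) (d : R) : 0 < d ->
  \forall q \near p, dist2 q.1 q.2 p.1 p.2 < d.
Proof.
move=> d0; pose D (q : R * V) := dist2 q.1 q.2 p.1 p.2.
have cD : continuous D.
  have c1 : continuous (fun q : R * V => q.1 - p.1).
    by apply: continuous_fun_add; [exact: continuous_fst_fun | exact: cst_continuous].
  apply: (@continuous_fun_add _ _ (fun q : R * V => (q.1 - p.1) ^+ 2)).
    have -> : (fun q : R * V => (q.1 - p.1) ^+ 2) = (fun q => (q.1 - p.1) * (q.1 - p.1)).
      by apply/funext => q; rewrite expr2.
    exact: continuous_fun_mul.
  apply: (@continuous_fun_comp _ _ _ (@sq R n)); last exact: continuous_sq.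
  by move=> q; apply: continuousB; [exact: cvg_snd | exact: cst_continuous].
have D0 : D p = 0 by rewrite /D /dist2 !subrr sq0 expr0n /= addr0.
have /cvgrPdist_lt /(_ d d0) := cD p; rewrite D0; apply: filterS => q.
by rewrite sub0r normrN ger0_norm // dist2_ge0.
Qed.

Lemma dist2_triangle (t s r : R) (x y z : V) :
  dist2 t x r z <= 2 * dist2 t x s y + 2 * dist2 s y r z.
Proof.
rewrite /dist2; have h : sq (x - z) <= 2 * sq (x - y) + 2 * sq (y - z).
  by apply: le_trans (sqD_le (x - y) (y - z)); rewrite addrA subrK.
have k : (t - r) ^+ 2 <= 2 * (t - s) ^+ 2 + 2 * (s - r) ^+ 2.
  have := sqr_ge0 ((t - s) - (s - r)); nra.
lra.
Qed.

(** Only [p] is confined to the box, while [q] is free; so compactness is used through coverings by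
    neighbourhoods rather than through uniform continuity of the restriction. *)
Lemma uniform_on_box (w : R -> V -> R) (T B e : R) :
  continuous (fun p : R * V => w p.1 p.2) -> 0 < e ->
  exists2 d, 0 < d & forall p q, box T B p -> dist2 q.1 q.2 p.1 p.2 < d ->
    `|w q.1 q.2 - w p.1 p.2| < e.
Proof.
move=> cw e0.
have e2 : 0 < e / 2 by rewrite divr_gt0.
have := (compact_near_coveringP (box T B)).1 (@compact_box T B).
pose P (d : R) (p : R * V) := forall q : R * V,
  dist2 q.1 q.2 p.1 p.2 < d -> `|w q.1 q.2 - w p.1 p.2| < e.
move=> /(_ R (0 : R)^'+ P _) H.
have {H} : \forall d \near 0^'+, box T B `<=` P d.
  apply: H => p _.
  have [d d0 hd] := @continuous_dist2 R n w p.1 p.2 (e / 2) cw e2.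
  (* [dist2] is a squared distance, and its triangle inequality carries factors [2]. *)
  have d4 : 0 < d / 4 by rewrite divr_gt0.
  near=> p' d' => q hq.
  have h1 : dist2 p'.1 p'.2 p.1 p.2 < d / 4 by near: p'; exact: near_dist2.
  have h2 : d' <= d / 4 by near: d'; exact: nbhs_right_le.
  have tri := dist2_triangle q.1 p'.1 p.1 q.2 p'.2 p.2.
  have k1 : `|w p'.1 p'.2 - w p.1 p.2| < e / 2.
    by apply: hd; lra.
  have k2 : `|w q.1 q.2 - w p.1 p.2| < e / 2.
    apply: hd; apply: le_lt_trans tri _; have h3 := lt_le_trans hq h2.
    have -> : d = 2 * (d / 4) + 2 * (d / 4) by lra.
    by apply: ltrD; rewrite ltr_pM2l.
  rewrite -(subrKA (w p.1 p.2)); apply: le_lt_trans (ler_normD _ _) _.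
  rewrite (distrC (w p.1 p.2)); lra.
move=> near_d.
have both : \forall d \near (0 : R)^'+, box T B `<=` P d /\ 0 < d.
  by near=> d; split; near: d; [exact: near_d | exact: nbhs_right_gt].
case: (@filter_ex _ _ (at_right_proper_filter 0) _ both) => d [hd d0].
exists d => // p q hp; exact: (hd p hp).
Unshelve. all: by end_near. Qed.

End Compactness.

Section ExpSup.
Variables (R : realType) (n : nat) (T mu : R).
Local Notation V := 'rV[R]_n.
Hypothesis mu0 : 0 <= mu.

(** The number [m] is the supremum of [w] divided by the time weight, positive because [w] is
    positive somewhere. A near-maximizer replaces a maximizer, which need not exist on an unbounded
    space. *)
Lemma exp_weighted_sup (w : R -> V -> R) (M t0 : R) (x0 : V) :
  (forall t x, 0 <= t <= T -> `|w t x| <= M) -> 0 <= t0 <= T -> 0 < w t0 x0 ->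
  exists m, [/\ 0 < m,
    (forall t x, 0 <= t <= T -> w t x <= m * expR (mu * (T - t))) &
    (forall d, 0 < d -> exists t x, 0 <= t <= T /\
        m * expR (mu * (T - t)) - d < w t x)].
Proof.
move=> wM ht0 w0.
pose E t := expR (mu * (T - t)).
have E0 t : 0 < E t by exact: expR_gt0.
have E1 t : 0 <= t <= T -> 1 <= E t.
  by move=> /andP[_ tT]; rewrite -expR0 ler_expR mulr_ge0 // subr_ge0.
pose S := [set r : R | exists t x, 0 <= t <= T /\ r = w t x / E t].
have hS : has_sup S.
  split; first by exists (w t0 x0 / E t0), t0, x0.
  exists M => _ [t [x [ht ->]]].
  rewrite ler_pdivrMr ?expR_gt0 //; apply: le_trans (ler_norm _) _.
  apply: le_trans (wM t x ht) _; apply: ler_peMr; last exact: E1.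
  exact: le_trans (normr_ge0 _) (wM t x ht).
exists (sup S); split.
- apply: (@lt_le_trans _ _ (w t0 x0 / E t0)); first by rewrite divr_gt0 // expR_gt0.
  by apply: sup_upper_bound => //; exists t0, x0.
- move=> t x ht; rewrite -ler_pdivrMr ?expR_gt0 //.
  by apply: sup_upper_bound => //; exists t, x.
(* The weight is largest at time [0], so tolerance [d / E 0] for the quotient gives tolerance [d]
   for [w] at every time. *)
- move=> d d0; have d' : 0 < d / E 0 by rewrite divr_gt0 // expR_gt0.
  have [_ [t [x [ht ->]]] h] := sup_adherent d' hS.
  exists t, x; split => //.
  move: h; rewrite ltr_pdivlMr ?expR_gt0 // mulrBl; apply: le_lt_trans.
  rewrite lerD2l lerN2 -mulrA ler_piMr ?(ltW d0) // mulrC ler_pdivrMr ?expR_gt0 // mul1r.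
  rewrite ler_expR ler_wpM2l //; move: ht => /andP[]; lra.
Qed.

End ExpSup.

Lemma sqr_le_bound (R : realType) (a r : R) : 0 < r -> r * a ^+ 2 <= 1 -> `|a| <= 1 + r^-1.
Proof.
move=> r0 h; have : a ^+ 2 <= r^-1 by rewrite -[r^-1]mulr1 ler_pdivlMl.
rewrite -real_normK ?num_real //; have := sqr_ge0 (`|a| - 1).
rewrite sqrrB1 real_normK ?num_real // => h1 h2.
move: (normr_ge0 a) h1 h2; nra.
Qed.

(** * Estimates of the error terms *)

Section Estimates.
Variables (R : realType) (n : nat).
Local Notation V := 'rV[R]_n.
Implicit Types (x y : V).

Lemma weighted_young (k : R) x y : 0 < k -> 2 * dotp x y <= k * sq x + sq y / k.
Proof.
move=> k0; have kN : k != 0 by rewrite gt_eqF.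
have -> : 2 * dotp x y = (2 * (k * dotp x y)) / k.
  by rewrite [X in X / _]mulrCA [X in X / _]mulrC mulfK.
have -> : k * sq x + sq y / k = (k ^+ 2 * sq x + sq y) / k.
  by rewrite mulrDl expr2 -(mulrA k) [X in _ = X / _ + _]mulrC mulfK.
by rewrite ler_pM2r ?invr_gt0 // -dotpZl -sqZ dotp_young.
Qed.

(** The factor [a * sq x] is absorbed by the exponential, uniformly in [x]. The localization
    gradient thus tends to zero with [a], and its product with the bounded drift is negligible. *)
Lemma well_gradient_sq_le (A a : R) x : 0 < a ->
  sq ((A * (expR (- (a * sq x)) * (2 * a))) *: x) <= 4 * A ^+ 2 * a.
Proof.
move=> a0; rewrite sqZ; set ex := expR _.
have asq0 : 0 <= a * sq x by rewrite mulr_ge0 ?sq_ge0 // ltW.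
have ex0 : 0 <= ex by exact: expR_ge0.
have h : a * sq x * ex * ex <= 1.
  rewrite -[X in _ <= X]mulr1; apply: ler_pM => //.
  - exact: mulr_ge0.
  - exact: mulr_expRN_le1.
  - exact: expRN_le1.
have -> : (A * (ex * (2 * a))) ^+ 2 * sq x = (4 * A ^+ 2 * a) * (a * sq x * ex * ex) by ring.
apply: ler_piMr => //; apply: mulr_ge0; last exact: ltW.
by apply: mulr_ge0 => //; exact: sqr_ge0.
Qed.

(** Bounds the quadratic errors from the drift and the jumps by the coupling itself, which is small
    at the maximum; no separate argument for [N] tending to infinity is required. *)
Lemma coupling_weight_le (t s : R) x y :
  expR (- dist2 t x s y) * sq (x - y) <= coupling t x s y.
Proof.
apply: le_trans (mulr_expRN_le (dist2 t x s y)); rewrite mulrC.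
by apply: ler_wpM2r; [exact: expR_ge0 | rewrite /dist2 lerDr sqr_ge0].
Qed.

Lemma enorm_le_sq (r : R) x : enorm x <= r -> sq x <= r ^+ 2.
Proof.
move=> h; rewrite -enorm_sqr ler_pXn2r ?nnegrE ?enorm_ge0 //.
exact: le_trans (enorm_ge0 _) h.
Qed.

Lemma lipschitz_dotp_le (b : V -> V) (L : R) x y :
  enorm (b x - b y) <= L * enorm (x - y) ->
  2 * dotp (b x - b y) (x - y) <= (L ^+ 2 + 1) * sq (x - y).
Proof.
move=> /enorm_le_sq; rewrite exprMn enorm_sqr => lip.
apply: le_trans (dotp_young _ _) _.
by rewrite mulrDl mul1r lerD2r.
Qed.

End Estimates.

Section Comparison.
Variables (R : realType) (n : nat).
Local Notation V := 'rV[R]_n.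
Local Notation bV := (borelRV R n).
Variables (nu : {measure set bV -> \bar R}) (b : V -> V) (F : V -> V -> V)
  (K : R) (rho : V -> R).
Hypothesis sett : standing_setting nu b F K rho.
Variables (T : R) (g : V -> R) (c f phi : R -> V -> R).
Hypothesis T0 : 0 < T.
Hypotheses (bc : bcont T c) (bf : bcont T f) (bphi : bcont T phi).
Variables (v1 v2 : R -> V -> R).
Hypothesis sub1 : visc_sub nu b F T g c f phi v1.
Hypothesis sup2 : visc_super nu b F T g c f phi v2.

Lemma half_le_onemexpN (r : R) : 1 <= r -> 2^-1 <= 1 - expR (- r).
Proof.
move=> r1; have := expRN1_le_half R.
have : expR (- r) <= expR (- 1) by rewrite ler_expR lerN2.
lra.
Qed.

(** Outside a compact set one of the penalties reaches half its height, which exceeds the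
    oscillation [2 * M] enough to bring the functional below its value at the doubled
    near-maximizer. That value is at least [- (2 * d)]: one [d] is lost by near-maximality and one
    by the well at [x0]. *)
Lemma penalized_maximum (M m mu A a N t0 : R) (x0 : V) (d : R) :
  (forall t x, 0 <= t <= T -> `|v1 t x| <= M) ->
  (forall t x, 0 <= t <= T -> `|v2 t x| <= M) ->
  0 <= m -> 0 <= mu -> 4 * M + 4 <= A -> 0 < a -> 4 * M + 5 <= N ->
  0 < d -> d <= 2^-1 -> 0 <= t0 <= T -> A * a * sq x0 <= d ->
  m * expR (mu * (T - t0)) - d < v1 t0 x0 - v2 t0 x0 ->
  exists t x s y, [/\ box T (1 + a^-1) (t, x), 0 <= s <= T,
    (forall t' x' s' y', 0 <= t' <= T -> 0 <= s' <= T ->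
     v1 t' x' - v2 s' y' - penalty T m mu A a N t' x' s' y' <=
     v1 t x - v2 s y - penalty T m mu A a N t x s y) &
    - (2 * d) <= v1 t x - v2 s y - penalty T m mu A a N t x s y].
Proof.
move=> M1 M2 m0 mu0 hA a0 hN d0 d1 ht0 hx0 hw.
have M0 : 0 <= M by apply: le_trans (normr_ge0 _) (M1 t0 x0 ht0).
have A0 : 0 <= A by lra.
have N0 : 0 <= N by lra.
have T0' := ltW T0.
pose w1 := clamped T v1; pose w2 := clamped T v2.
have [bv1 _ _] := sub1; have [bv2 _ _] := sup2.
pose Q (z : (R * V) * (R * V)) := w1 z.1.1 z.1.2 - w2 z.2.1 z.2.2 -
  penalty T m mu A a N z.1.1 z.1.2 z.2.1 z.2.2.
(* Where [a * sq x] is at most [1], the coordinates of [x] are at most [B]. The second box is larger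
   by [1], so a [y] outside it is at distance at least [1] from such an [x]. *)
pose B := 1 + a^-1.
pose S := box T B `*` box T (B + 1) : set ((R * V) * (R * V)).
have cf1 (g' : R * V -> R) : continuous g' -> continuous (fun z : (R * V) * (R * V) => g' z.1).
  by move=> cg'; apply: continuous_fun_comp => //; exact: continuous_fst_fun.
have cf2 (g' : R * V -> R) : continuous g' -> continuous (fun z : (R * V) * (R * V) => g' z.2).
  by move=> cg'; apply: continuous_fun_comp => //; exact: continuous_snd_fun.
have cexpN (X : topologicalType) (h : X -> R) : continuous h ->
    continuous (fun z => 1 - expR (- h z)).
  move=> ch; apply: continuous_fun_add; first exact: cst_continuous.
  apply: continuous_fun_opp; apply: (@continuous_fun_comp _ _ _ (@expR R)).
    exact: continuous_fun_opp.
  exact: continuous_expR.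
have csq : continuous (fun p : R * V => sq p.2).
  by apply: (@continuous_fun_comp _ _ _ (@sq R n)); [exact: continuous_snd_fun | exact: continuous_sq].
have cdist : continuous (fun z : (R * V) * (R * V) => dist2 z.1.1 z.1.2 z.2.1 z.2.2).
  have c1 : continuous (fun z : (R * V) * (R * V) => z.1.1 - z.2.1).
    apply: continuous_fun_add; first by apply: cf1; exact: continuous_fst_fun.
    by apply: continuous_fun_opp; apply: cf2; exact: continuous_fst_fun.
  apply: (@continuous_fun_add _ _ (fun z : (R * V) * (R * V) => (z.1.1 - z.2.1) ^+ 2)).
    have -> : (fun z : (R * V) * (R * V) => (z.1.1 - z.2.1) ^+ 2) =
      (fun z => (z.1.1 - z.2.1) * (z.1.1 - z.2.1)).
      by apply/funext => z; rewrite expr2.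
    exact: continuous_fun_mul.
  apply: (@continuous_fun_comp _ _ _ (@sq R n)); last exact: continuous_sq.
  have k1 : continuous (fun z : (R * V) * (R * V) => z.1.2).
    by apply: continuous_fun_comp; [exact: continuous_fst_fun | exact: continuous_snd_fun].
  have k2 : continuous (fun z : (R * V) * (R * V) => z.2.2).
    by apply: continuous_fun_comp; [exact: continuous_snd_fun | exact: continuous_snd_fun].
  exact: (@continuous_fun_sub R V).
have cE : continuous (fun p : R * V => m * expR (mu * (T - p.1))).
  apply: continuous_fun_mul; first exact: cst_continuous.
  apply: (@continuous_fun_comp _ _ _ (@expR R)); last exact: continuous_expR.
  apply: continuous_fun_mul; first exact: cst_continuous.
  apply: continuous_fun_add; first exact: cst_continuous.
  by apply: continuous_fun_opp; exact: continuous_fst_fun.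
have cQ : continuous Q.
  apply: continuous_fun_add.
    apply: continuous_fun_add.
      apply: (cf1 (fun p => w1 p.1 p.2)); exact: continuous_clamped.
    apply: continuous_fun_opp.
    apply: (cf2 (fun p => w2 p.1 p.2)); exact: continuous_clamped.
  apply: continuous_fun_opp; apply: continuous_fun_add; first apply: continuous_fun_add.
  - exact: (cf1 (fun p => m * expR (mu * (T - p.1)))).
  - apply: (cf1 (fun p => A * well a p.2)).
    apply: continuous_fun_mul; first exact: cst_continuous.
    apply: (cexpN _ (fun p : R * V => a * sq p.2)).
    by apply: continuous_fun_mul; first exact: cst_continuous.
  - apply: continuous_fun_mul; first exact: cst_continuous.
    exact: cexpN.
have QE t x s y : 0 <= t <= T -> 0 <= s <= T ->
    Q ((t, x), (s, y)) = v1 t x - v2 s y - penalty T m mu A a N t x s y.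
  by move=> ht hs; rewrite /Q /= /w1 /w2 !clampedE.
have wl : A * well a x0 <= d.
  apply: le_trans hx0; rewrite -mulrA; apply: ler_wpM2l => //.
  by have := expRN_ge1B (a * sq x0); rewrite /well; move: (a * sq x0) => q; lra.
have Q0 : - (2 * d) <= Q ((t0, x0), (t0, x0)).
  rewrite QE // /penalty /coupling /dist2 !subrr sq0 expr0n /= addr0 oppr0 expR0 subrr mulr0.
  lra.
have S0 : S ((t0, x0), (t0, x0)).
  have hB i : `|x0 0 i| <= B.
    apply: sqr_le_bound => //.
    apply: (@le_trans _ _ (a * sq x0)).
      by apply: ler_wpM2l; [exact: ltW | exact: coord_sqr_le].
    have A4 : 4 <= A by lra.
    have s0 : 0 <= a * sq x0 by rewrite mulr_ge0 ?sq_ge0 // ltW.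
    have : 4 * (a * sq x0) <= A * (a * sq x0) by apply: ler_wpM2r.
    rewrite mulrA -mulrA in hx0 *; rewrite mulrA; lra.
  by split; split => //= i; apply: le_trans (hB i) _; rewrite lerDl.
have cS : compact S by apply: compact_setX; exact: compact_box.
have [[[t x] [s y]] /set_mem zS zmax] :=
  @compact_EVT_max _ R Q S (ex_intro _ _ S0) cS (continuous_subspaceT cQ).
move: zS => -[[/= ht hx] [/= hs hy]].
have Qz : - (2 * d) <= Q ((t, x), (s, y)).
  by apply: le_trans Q0 _; apply: zmax; exact: mem_set.
exists t, x, s, y; split => //; last by rewrite -QE.
move=> t' x' s' y' ht' hs'; rewrite -!QE //.
have [inS|outS] := pselect (S ((t', x'), (s', y'))); first by apply: zmax; exact: mem_set.
apply: le_trans Qz.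
(* The functional is then at most [-1], hence at most [- (2 * d)] since [d] is at most one half. *)
have small : 2 * M + 1 <= penalty T m mu A a N t' x' s' y' ->
    Q (t', x', (s', y')) <= - (2 * d).
  rewrite QE // => h.
  have := M1 t' x' ht'; have := M2 s' y' hs'.
  rewrite !ler_norml => /andP[h1 _] /andP[_ h2]; lra.
apply: small.
have mE : 0 <= m * expR (mu * (T - t')) by rewrite mulr_ge0 ?expR_ge0.
have W0 : 0 <= A * well a x' by rewrite mulr_ge0 // well_ge0 // ltW.
have C0 : 0 <= N * coupling t' x' s' y' by rewrite mulr_ge0 // coupling_ge0.
have [near0|far] := pselect (a * sq x' <= 1); last first.
  have W : A * 2^-1 <= A * well a x'.
    apply: ler_wpM2l => //; apply: half_le_onemexpN.
    by apply: ltW; rewrite ltNge; apply/negP.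
  rewrite /penalty; lra.
have hx' i : `|x' 0 i| <= B.
  apply: sqr_le_bound => //; apply: le_trans near0.
  by apply: ler_wpM2l; [exact: ltW | exact: coord_sqr_le].
have [i hi] : exists i, ~ (`|y' 0 i| <= B + 1).
  by apply/existsNP => hy'; apply: outS; split.
have C : N * 2^-1 <= N * coupling t' x' s' y'.
  apply: ler_wpM2l => //; apply: half_le_onemexpN.
  apply: (@le_trans _ _ (sq (x' - y'))); last by rewrite /dist2 lerDr sqr_ge0.
  apply: le_trans (coord_sqr_le (x' - y') i).
  have -> : (x' - y') 0 i = x' 0 i - y' 0 i by rewrite !mxE.
  have : 1 <= `|x' 0 i - y' 0 i|.
    have := hx' i.
    have : B + 1 < `|y' 0 i| by rewrite ltNge; apply/negP.
    rewrite (distrC (x' 0 i)).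
    have := ler_normD (y' 0 i - x' 0 i) (x' 0 i); rewrite subrK; lra.
  rewrite -[X in _ -> _ <= X]real_normK ?num_real // => h.
  by rewrite -[X in X <= _](expr1n _ 2) ler_pXn2r ?nnegrE.
rewrite /penalty; lra.
Qed.


End Comparison.

(** Suppose [v1] exceeds [v2] somewhere, so that [m] is positive. The doubling inequality at a
    penalized maximum gives [mu * E <= M * E + d * Q], where [E] is the time weight there and [Q]
    depends only on the data and [M]. The choice of [d] contradicts this. *)
Lemma comparison (R : realType) (n : nat)
    (nu : {measure set (borelRV R n) -> \bar R})
    (b : 'rV[R]_n -> 'rV[R]_n) (F : 'rV[R]_n -> 'rV[R]_n -> 'rV[R]_n)
    (K : R) (rho : 'rV[R]_n -> R) (T : R) (g : 'rV[R]_n -> R)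
    (c f phi v1 v2 : R -> 'rV[R]_n -> R) (t0 : R) (x0 : 'rV[R]_n) :
  standing_setting nu b F K rho -> 0 < T ->
  bcont T c -> bcont T f -> bcont T phi ->
  visc_sub nu b F T g c f phi v1 -> visc_super nu b F T g c f phi v2 ->
  0 <= t0 <= T -> v1 t0 x0 <= v2 t0 x0.
Proof.
move=> sett T0 bc bf bphi sub1 sup2 ht0; rewrite leNgt; apply/negP => neg.
have T0' := ltW T0.
have hT : 0 <= T <= T by rewrite T0' lexx.
have [bv1 le_g _] := sub1; have [bv2 ge_g _] := sup2.
have [_ [[Bb hBb] [Lb hLb] _ K0 _]] := sett.
have [M [M1 M2 Mc]] : exists M, [/\ (forall t x, 0 <= t <= T -> `|v1 t x| <= M),
    (forall t x, 0 <= t <= T -> `|v2 t x| <= M) &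
    (forall t x, 0 <= t <= T -> `|c t x| <= M)].
  have [_ [N1 h1]] := bv1; have [_ [N2 h2]] := bv2; have [_ [N3 h3]] := bc.
  exists (Num.max N1 (Num.max N2 N3)); split=> t x ht; rewrite !le_max.
  - by rewrite h1.
  - by rewrite h2 // orbT.
  - by rewrite h3 // !orbT.
have M0 : 0 <= M by apply: le_trans (normr_ge0 _) (M1 t0 x0 ht0).
(* [M] bounds [c], so the term in [c] costs [M * E] and one full [E] is left over. *)
pose mu := M + 1; have mu0 : 0 <= mu by rewrite addr_ge0.
have wb t x : 0 <= t <= T -> `|v1 t x - v2 t x| <= M + M.
  move=> ht; apply: le_trans (ler_normB _ _) _.
  by apply: lerD; [exact: M1 | exact: M2].
have w0 : 0 < v1 t0 x0 - v2 t0 x0 by rewrite subr_gt0.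
have [m [m0 hm hmd]] := exp_weighted_sup mu0 wb ht0 w0.
(* Collects the errors in units of [d]: coupling drift, coupling jumps and the term in [c]. The [5]
   covers localization drift, localization jumps, the oscillation of [f] and the limit error, and it
   also yields [5 * d < m]. *)
pose Q := 5 + 3 * (Lb ^+ 2 + 1) + 3 * K + 3 * M.
have L0 := sqr_ge0 Lb.
have Q5 : 5 <= Q by rewrite /Q; lra.
pose d := Num.min 2^-1 (m / (Q + 1)).
have Q1 : 0 < Q + 1 by lra.
have d0 : 0 < d by rewrite lt_min invr_gt0 ltr0n divr_gt0.
have d2 : d <= 2^-1 by rewrite ge_min lexx.
have dm : d * (Q + 1) <= m by rewrite -ler_pdivlMr // ge_min lexx orbT.
have dm5 : d * 5 < m.
  apply: lt_le_trans dm; rewrite ltr_pM2l //; lra.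
have [ta [xa [hta hxa]]] := hmd d d0.
pose A := 4 * M + 4.
have A4 : 4 <= A by rewrite /A; lra.
have A0 : 0 < A by lra.
(* Weight in Young's inequality for the bounded drift against the localization gradient. *)
pose kap := d / (Bb ^+ 2 + 1).
have B1 : 0 < Bb ^+ 2 + 1 by rewrite ltr_wpDl ?sqr_ge0.
have kap0 : 0 < kap by rewrite divr_gt0.
have kapB : kap * Bb ^+ 2 <= d.
  rewrite /kap -mulrA ler_piMr ?(ltW d0) // mulrC ler_pdivrMr // mul1r lerDl //.
(* Three upper bounds on [a] are met at once by dividing [d] by the sum: they control the well at
   [xa], the jump integral of the well, and its gradient. *)
pose D1 := A * (sq xa + 1); pose D2 := A * (K + 1); pose D3 := 4 * A ^+ 2 / kap.
have D10 : 0 < D1 by rewrite mulr_gt0 // ltr_wpDl ?sq_ge0.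
have D20 : 0 < D2 by rewrite mulr_gt0 // addr_gt0.
have D30 : 0 < D3 by rewrite divr_gt0 // mulr_gt0 // exprn_gt0.
pose a := d / (D1 + D2 + D3).
have a0 : 0 < a by rewrite divr_gt0 // !addr_gt0.
have aD D : 0 <= D -> D <= D1 + D2 + D3 -> a * D <= d.
  move=> D0 hD; rewrite /a mulrAC ler_pdivrMr ?addr_gt0 //.
  by rewrite ler_pM2l.
have a1 : A * a * sq xa <= d.
  have -> : A * a * sq xa = a * (A * sq xa) by ring.
  apply: aD; first by rewrite mulr_ge0 ?sq_ge0 // ltW.
  have : A * sq xa <= D1 by rewrite /D1 mulrDr mulr1 lerDl ltW.
  lra.
have a2 : A * a * K <= d.
  have -> : A * a * K = a * (A * K) by ring.
  apply: aD; first by rewrite mulr_ge0 // ltW.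
  have : A * K <= D2 by rewrite /D2 mulrDr mulr1 lerDl ltW.
  lra.
have a3 : 4 * A ^+ 2 * a / kap <= d.
  have -> : 4 * A ^+ 2 * a / kap = a * D3 by rewrite /D3; ring.
  by apply: aD; [exact: ltW | lra].
pose B := 1 + a^-1.
have unif (w : R -> 'rV[R]_n -> R) : bcont T w -> exists2 e, 0 < e &
    forall t x s y, box T B (t, x) -> 0 <= s <= T -> dist2 t x s y < e ->
      `|w s y - w t x| < d.
  move=> bw; have [e e0 he] := @uniform_on_box R n (clamped T w) T B d (continuous_clamped T0' bw) d0.
  exists e => // t x s y hp hs hd.
  have [/= ht _] := hp.
  have := he (t, x) (s, y) hp; rewrite /= !clampedE //; apply.
  by rewrite dist2C.
have [e1 e10 u1] := unif _ bv1; have [e2 e20 u2] := unif _ bv2.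
have [e3 e30 u3] := unif _ bc; have [e4 e40 u4] := unif _ bf.
have [e5 e50 u5] := unif _ bphi.
pose e := Num.min e1 (Num.min e2 (Num.min e3 (Num.min e4 e5))).
have e0 : 0 < e by rewrite !lt_min e10 e20 e30 e40.
have ew : 0 < 1 - expR (- e) by rewrite subr_gt0 -expR0 ltr_expR oppr_lt0.
(* The second summand makes the coupling cost at least [2 * M + 2] at squared distance [e] or more,
   more than [v1 - v2] can compensate. *)
pose N := 4 * M + 5 + (2 * M + 2) / (1 - expR (- e)).
have Ne : 0 <= (2 * M + 2) / (1 - expR (- e)) by rewrite divr_ge0 ?(ltW ew) //; clear - M0; lra.
have N5 : 4 * M + 5 <= N by rewrite /N lerDl.
have N0 : 0 <= N by clear - N5 M0; lra.
have [t [x [s [y [hb hs Hmax hlow]]]]] :=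
  penalized_maximum T0 sub1 sup2 M1 M2 (ltW m0) mu0 (lexx A) a0 N5 d0 d2 hta a1 hxa.
have [/= ht _] := hb.
pose E := m * expR (mu * (T - t)).
have mE : m <= E.
  apply: ler_peMr; first exact: ltW.
  by rewrite -expR0 ler_expR mulr_ge0 // subr_ge0; move: ht => /andP[].
have W0 : 0 <= A * well a x by rewrite mulr_ge0 ?(ltW A0) // well_ge0 // ltW.
have C0 : 0 <= N * coupling t x s y by rewrite mulr_ge0 // coupling_ge0.
have low : E + A * well a x + N * coupling t x s y - 2 * d <= v1 t x - v2 s y.
  by move: hlow; rewrite /penalty -/E; clear; lra.
have near_diag : dist2 t x s y < e.
  rewrite ltNge; apply/negP => far.
  have h1 : N * (1 - expR (- e)) <= N * coupling t x s y.
    by apply: ler_wpM2l => //; rewrite lerD2l lerN2 ler_expR lerN2.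
  have h2 : 2 * M + 2 <= N * (1 - expR (- e)).
    have qe : (2 * M + 2) / (1 - expR (- e)) * (1 - expR (- e)) = 2 * M + 2.
      by rewrite divfK // gt_eqF.
    rewrite /N (mulrDl (4 * M + 5)) qe lerDr mulr_ge0 ?(ltW ew) //.
    by clear - M0; lra.
  have := M1 t x ht; have := M2 s y hs; rewrite !ler_norml => /andP[k1 _] /andP[_ k2].
  clear - h1 h2 k1 k2 low W0 d2 mE m0; lra.
have [n1 n2 n3 n4 n5] : [/\ dist2 t x s y < e1, dist2 t x s y < e2, dist2 t x s y < e3,
    dist2 t x s y < e4 & dist2 t x s y < e5].
  by move: near_diag; rewrite !lt_min => /andP[-> /andP[-> /andP[-> /andP[-> ->]]]].
have {u1} := u1 t x s y hb hs n1; have {u2} := u2 t x s y hb hs n2.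
have {u3} u3 := u3 t x s y hb hs n3.
have {u4} := u4 t x s y hb hs n4; have {u5} := u5 t x s y hb hs n5.
rewrite !ltr_norml => /andP[u5 u5'] /andP[u4 u4'] /andP[u2 u2'] /andP[u1 u1'].
(* Here it matters that [m] is the supremum: comparison of [up] with [low] leaves at most [3 * d]
   for the coupling term. *)
have up : v1 t x - v2 s y <= E + d.
  by have := hm t x ht; rewrite -/E; clear - u2 u2'; lra.
have coup3 : N * coupling t x s y <= 3 * d by clear - low up W0; lra.
(* At time [T] the terminal inequalities give [v1 <= v2], so [v1 t x - v2 s y] would be below [d],
   while [low] puts it above [3 * d]. *)
have tT : 0 <= t < T.
  move: (ht) => /andP[-> tT] /=; rewrite lt_neqAle tT andbT.
  apply/eqP => tE; have := le_g x; have := ge_g x; rewrite -tE.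
  clear - u2 u2' low W0 C0 mE dm5 d0; lra.
have sT : 0 <= s < T.
  move: (hs) => /andP[-> sT] /=; rewrite lt_neqAle sT andbT.
  apply/eqP => sE; have := le_g y; have := ge_g y; rewrite -sE.
  clear - u1 u1' low W0 C0 mE dm5 d0; lra.
have obst : phi t x - phi s y < v1 t x - v2 s y.
  by clear - u5 u5' low W0 C0 mE dm5 d0; lra.
have main := doubling_inequality sett T0 sub1 sup2 mu0 (ltW A0) (ltW a0) N0 tT sT Hmax obst d0.
rewrite -/E in main.
set ed := expR (- dist2 t x s y) in main.
set ex := expR (- (a * sq x)) in main.
have ed0 : 0 <= ed by exact: expR_ge0.
have q0 := sq_ge0 (x - y).
have Nsq : N * ed * sq (x - y) <= 3 * d.
  apply: le_trans coup3; rewrite -mulrA; apply: ler_wpM2l => //.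
  exact: coupling_weight_le.
have drift2 : N * (ed * 2) * dotp (b x - b y) (x - y) <= 3 * (Lb ^+ 2 + 1) * d.
  have -> : N * (ed * 2) * dotp (b x - b y) (x - y) =
    (N * ed) * (2 * dotp (b x - b y) (x - y)) by ring.
  apply: (@le_trans _ _ ((N * ed) * ((Lb ^+ 2 + 1) * sq (x - y)))).
    by apply: ler_wpM2l; [exact: mulr_ge0 | exact: lipschitz_dotp_le].
  have -> : N * ed * ((Lb ^+ 2 + 1) * sq (x - y)) = (Lb ^+ 2 + 1) * (N * ed * sq (x - y)) by ring.
  have -> : 3 * (Lb ^+ 2 + 1) * d = (Lb ^+ 2 + 1) * (3 * d) by ring.
  by apply: ler_wpM2l Nsq; rewrite addr_ge0.
have drift1 : A * (ex * (2 * a)) * dotp (b x) x <= d.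
  pose z := (A * (ex * (2 * a))) *: x.
  have -> : A * (ex * (2 * a)) * dotp (b x) x = dotp (b x) z by rewrite dotpZr.
  have h1 := weighted_young (b x) z kap0.
  have h2 : kap * sq (b x) <= d.
    apply: le_trans kapB; apply: ler_wpM2l; first exact: ltW.
    exact: enorm_le_sq (hBb x).
  have h3 : sq z / kap <= d.
    by apply: le_trans a3; rewrite ler_pM2r ?invr_gt0 //; exact: well_gradient_sq_le.
  clear - h1 h2 h3; lra.
(* The difference of the products splits into [c] times the gap of the solutions, which is [E] up to
   [2 * d], and the oscillation of [c] times [v2]. *)
have cterm : - (c t x * v1 t x - c s y * v2 s y) <= M * (E + 2 * d) + M * d.
  have -> : - (c t x * v1 t x - c s y * v2 s y) =
    - (c t x * (v1 t x - v2 s y)) + (c s y - c t x) * v2 s y by ring.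
  apply: lerD.
    apply: le_trans (ler_norm _) _; rewrite normrN normrM.
    apply: ler_pM => //; first exact: Mc.
    rewrite ler_norml; clear - low up W0 C0 d0 mE m0.
    by apply/andP; split; lra.
  apply: le_trans (ler_norm _) _; rewrite normrM mulrC.
  by apply: ler_pM => //; [exact: M2 | exact: ltW].
have KN : N * ed * (K * sq (x - y)) <= 3 * K * d.
  have -> : N * ed * (K * sq (x - y)) = K * (N * ed * sq (x - y)) by ring.
  have -> : 3 * K * d = K * (3 * d) by ring.
  by apply: ler_wpM2l => //; exact: ltW.
have fin : E <= d * Q.
  have -> : d * Q = d * 5 + 3 * (Lb ^+ 2 + 1) * d + 3 * K * d + 3 * M * d by rewrite /Q; ring.
  have muE : mu * E = M * E + E by rewrite /mu mulrDl mul1r.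
  have Md : M * (E + 2 * d) + M * d = M * E + 3 * M * d by ring.
  rewrite muE in main; rewrite Md in cterm.
  move: main cterm KN drift1 drift2 a2 u4 u4'.
  move: (_ * dotp (b x) x) (_ * dotp (b x - b y) _) (A * a * K) (N * ed * _) (M * E)
    (c t x * _ - _) (3 * (Lb ^+ 2 + 1) * d) (3 * K * d) (3 * M * d)
    => x1 x2 x3 x4 x5 x6 x7 x8 x9 main cterm KN drift1 drift2 a2' u4 u4'.
  clear - main cterm KN drift1 drift2 a2' u4 u4'; lra.
(* The chain [d * (Q + 1) <= m <= E <= d * Q] is impossible for positive [d]. *)
have := le_trans dm (le_trans mE fin).
by rewrite mulrDr mulr1 gerDl leNgt d0.
Qed.

Theorem mainTheorem9 (R : realType) (n : nat)
  (nu : {measure set (borelRV R n) -> \bar R})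
  (b : 'rV[R]_n -> 'rV[R]_n) (F : 'rV[R]_n -> 'rV[R]_n -> 'rV[R]_n)
  (K : R) (rho : 'rV[R]_n -> R)
  (T : R) (g : 'rV[R]_n -> R) (c f phi : R -> 'rV[R]_n -> R) :
  standing_setting nu b F K rho ->
  0 < T -> bcontx g -> bcont T c -> bcont T f -> bcont T phi ->
  (forall x, phi T x <= g x) ->
  (forall x, F x y @[y --> (0 : 'rV[R]_n)^'] --> (0 : 'rV[R]_n)) ->
  forall v1 v2 : R -> 'rV[R]_n -> R,
    visc_solution nu b F T g c f phi v1 ->
    visc_solution nu b F T g c f phi v2 ->
    forall t x, 0 <= t <= T -> v1 t x = v2 t x.
Proof.
move=> sett T0 _ bc bf bphi _ _ v1 v2 [sub1 sup1] [sub2 sup2] t x ht.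
apply: le_anti; apply/andP; split.
  exact: (@comparison R n nu b F K rho T g c f phi).
exact: (@comparison R n nu b F K rho T g c f phi).
Qed.
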